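(* Let $\mathcal H$ be a regular unitarily invariant space on $\mathbb B_d$ that does not admit non-empty $\operatorname{Mult}(\mathcal H)$-totally null sets. Then a compact set $E\subset\partial\mathbb B_d$ is an interpolation set for $A(\mathcal H)$ if and only if $E$ is finite.
   Context: Let $d\in\mathbb N$, let $\mathbb B_d\subset\mathbb C^d$ be the Euclidean open unit ball and $\partial\mathbb B_d$ the unit sphere. A regular unitarily invariant space on $\mathbb B_d$ is a reproducing kernel Hilbert space $\mathcal H$ on $\mathbb B_d$ with kernel $K(z,w)=\sum_{n=0}^\infty a_n\langle z,w\rangle^n$, where $a_0=1$, $a_n>0$ for all $n$, and $\lim_{n\to\infty} a_n/a_{n+1}=1$. $\operatorname{Mult}(\mathcal H)$ is the multiplier algebra, normed by $\|f\|_{\operatorname{Mult}(\mathcal H)}=\|M_f\|_{B(\mathcal H)}$, where $M_f$ is multiplication by $f$. Via $f\mapsto M_f$ it is a WOT-closed subalgebra of $B(\mathcal H)$, and its weak-$*$ topology is that of the dual of $\mathcal T(\mathcal H)/\operatorname{Mult}(\mathcal H)_\perp$, where $\mathcal T(\mathcal H)$ is the trace class. $A(\mathcal H)$ is the norm closure of $\mathbb C[z_1,\dots,z_d]$ in $\operatorname{Mult}(\mathcal H)$; its elements extend uniquely to continuous functions on $\overline{\mathbb B_d}$. A (complex) regular Borel measure $\mu$ on $\partial\mathbb B_d$ is $\operatorname{Mult}(\mathcal H)$-Henkin if $p\mapsto\int_{\partial\mathbb B_d} p\,d\mu$ on polynomials extends to a weak-$*$ continuous functional on $\operatorname{Mult}(\mathcal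 H)$. A Borel set $E\subset\partial\mathbb B_d$ is $\operatorname{Mult}(\mathcal H)$-totally null if $|\mu|(E)=0$ for every $\operatorname{Mult}(\mathcal H)$-Henkin measure $\mu$. A compact set $E\subset\partial\mathbb B_d$ is an interpolation set for $A(\mathcal H)$ if the restriction map $A(\mathcal H)\to C(E)$, $f\mapsto f|_E$, is surjective. *)

(* Defs.v *)
From HB Require Import structures.
From mathcomp Require Import all_boot all_order all_algebra.
From mathcomp Require Import complex.
From mathcomp Require Import all_classical all_reals all_analysis.
From mathcomp Require mpoly.

Set Implicit Arguments.
Unset Strict Implicit.
Unset Printing Implicit Defensive.

Import Order.TTheory GRing.Theory Num.Theory.
Import numFieldNormedType.Exports.

Local Open Scope classical_set_scope.
Local Open Scope ring_scope.
Local Open Scope complex_scope.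

(* R[i] carries its usual topology, as an abstract numFieldType does. *)
HB.instance Definition _ (R : rcfType) := NormedModule.copy R[i] R[i]^o.
HB.instance Definition _ (R : rcfType) := Num.ClosedField.on R[i].

(* `|x| is an element of R[i] with zero imaginary part. *)
Definition rnorm (R : realType) (V : normedModType R[i]) (x : V) : R :=
  complex.Re `|x|.

Section Euclidean.
Variables (R : realType) (d : nat).

Definition cdot (z w : 'rV[R[i]]_d) : R[i] := \sum_i z 0 i * Num.conj (w 0 i).

(* The norm of the library on 'rV is the maximum norm, hence the explicit
   Euclidean norm; the order on R[i] compares real parts and requires equal
   imaginary parts, here 0. *)
Definition unit_ball : set 'rV[R[i]]_d := [set z | cdot z z < 1].
Definition unit_sphere : set 'rV[R[i]]_d := [set z | cdot z z = 1].
Definition closed_unit_ball : set 'rV[R[i]]_d := [set z | cdot z z <= 1].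

Definition polynomial := mpoly.mpoly d R[i].
Definition peval (p : polynomial) (z : 'rV[R[i]]_d) : R[i] :=
  mpoly.meval (fun i => z 0 i) p.

End Euclidean.

(* Vectors of the Hilbert space are functions on X through the injective
   linear map fval; the inner product is linear in its first argument. *)
Record rkhs (R : realType) (X : Type) := RKHS {
  rkhs_space :> completeNormedModType R[i] ;
  inner : {dot rkhs_space for Num.conj} ;
  inner_norm : forall u, inner u u = `|u| ^+ 2 ;
  fval : {linear rkhs_space -> (X -> R[i])} ;
  fval_inj : injective fval ;
  kvec : X -> rkhs_space ;
  reproducing : forall h w, fval h w = inner h (kvec w) }.

Arguments inner {R X} r.
Arguments fval {R X} r.
Arguments kvec {R X} r.

Definition kernel (R : realType) (X : Type) (H : rkhs R X) (z w : X) : R[i] :=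
  fval H (kvec H w) z.

Definition regular_unitarily_invariant (R : realType) (d : nat)
    (H : rkhs R (@unit_ball R d)) : Prop :=
  exists a : nat -> R,
    [/\ a 0%N = 1,
        forall n, 0 < a n,
        (fun n => a n / a n.+1) @ \oo --> (1 : R) &
        forall z w : @unit_ball R d,
          series (fun n => (a n)%:C * cdot (set_val z) (set_val w) ^+ n) @ \oo
            --> kernel H z w].

Section Multipliers.
Variables (R : realType) (X : Type) (H : rkhs R X).
Local Notation C := R[i].

Definition is_multiplier (f : X -> C) : Prop :=
  forall h : H, exists g : H, fval H g = f * fval H h.

Definition multiplier_pred : {pred X -> C} := fun f => `[< is_multiplier f >].

Record multiplier := Multiplier {
  mfun :> X -> C ;
  mfunP : mfun \in multiplier_pred }.

HB.instance Definition _ := [isSub for mfun].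
HB.instance Definition _ := [Choice of multiplier by <:].

Lemma multiplier_submod_closed : submod_closed multiplier_pred.
Proof.
split=> [|a f g /asboolP fM /asboolP gM]; apply/asboolP => h.
  by exists 0; rewrite raddf0 mul0r.
have [[u uE] [v vE]] := (fM h, gM h).
exists (a *: u + v); rewrite linearP uE vE mulrDl; congr (_ + _).
apply/funext => x; rewrite !fctE. exact: mulrA.
Qed.

HB.instance Definition _ :=
  GRing.isSubmodClosed.Build C (X -> C) multiplier_pred multiplier_submod_closed.
HB.instance Definition _ := [SubChoice_isSubLmodule of multiplier by <:].

(* M_f; the vector is unique because fval is injective. *)
Definition mulop (f : multiplier) (h : H) : H :=
  xget 0 [set g : H | fval H g = mfun f * fval H h].

Definition opnorm (T : H -> H) : \bar R :=
  ereal_sup [set (rnorm (T h))%:E | h in [set h : H | `|h| <= 1]].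

Definition mult_norm (f : multiplier) : \bar R := opnorm (mulop f).

(* A = sum_n <., y_n> x_n with sum_n |x_n| |y_n| < oo *)
Definition nuclear_expansion (A : H -> H) (x y : nat -> H) : Prop :=
  cvgn (series (fun n => rnorm (x n) * rnorm (y n))) /\
  forall h, series (fun n => inner H h (y n) *: x n) @ \oo --> A h.

Definition trace_class : set (H -> H) :=
  [set A | exists x y, nuclear_expansion A x y].

(* The value does not depend on the nuclear expansion chosen. *)
Definition trace (A : H -> H) : C :=
  xget 0 [set t : C | exists x y, nuclear_expansion A x y /\
    series (fun n => inner H (x n) (y n)) @ \oo --> t].

Definition trace_pairing (f : multiplier) : {ptws trace_class -> C} :=
  fun A => trace (mulop f \o set_val A).

(* The topology of trace_pairing is the coarsest one for which every functional
   f |-> tr (M_f A), A of trace class, is continuous.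
   Such a functional only depends on A modulo the preannihilator of Mult(H). *)
Definition weak_star_continuous (phi : multiplier -> C) : Prop :=
  continuous (phi : initial_topology trace_pairing -> C).

End Multipliers.

Notation borel R d := (g_sigma_algebraType (@open 'rV[R[i]]_d)).

Section ComplexMeasures.
Variables (R : realType) (d : nat).
Local Notation C := R[i].

Local Notation borel := (borel R d) (only parsing).

Record complex_measure := ComplexMeasure {
  re_part : {charge set borel -> \bar R} ;
  im_part : {charge set borel -> \bar R} }.

Definition cmeas (mu : complex_measure) (A : set borel) : C :=
  fine (re_part mu A) +i* fine (im_part mu A).

Definition total_variation (mu : complex_measure) (A : set borel) : \bar R :=
  ereal_sup [set (\sum_(k <oo) (rnorm (cmeas mu (F k)))%:E)%E |
    F in [set F : nat -> set borel |
      [/\ forall k, measurable (F k), trivIset setT F & \bigcup_k F k = A]]].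

Definition regular_measure (mu : complex_measure) : Prop :=
  forall A : set borel, measurable A ->
    total_variation mu A = ereal_inf [set total_variation mu U |
      U in [set U : set 'rV[C]_d | open U /\ A `<=` U]] /\
    total_variation mu A = ereal_sup [set total_variation mu K |
      K in [set K : set 'rV[C]_d | compact K /\ K `<=` A]].

(* The regular complex Borel measures on the sphere, identified with those on
   C^d that vanish off the sphere. *)
Definition sphere_measure (mu : complex_measure) : Prop :=
  regular_measure mu /\ total_variation mu (~` @unit_sphere R d) = 0%E.

Lemma hahn_pair_ex (nu : {charge set borel -> \bar R}) :
  exists PN : set borel * set borel, hahn_decomposition nu PN.1 PN.2.
Proof. by have [P [N nuPN]] := Hahn_decomposition nu; exists (P, N). Qed.

Definition charge_integral (nu : {charge set borel -> \bar R}) (D : set borel)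
    (u : borel -> R) : R :=
  let nuPN := projT2 (cid (hahn_pair_ex nu)) in
  \int[jordan_pos nuPN]_(x in D) u x - \int[jordan_neg nuPN]_(x in D) u x.

Definition cintegral (mu : complex_measure) (D : set borel) (f : borel -> C) : C :=
  (charge_integral (re_part mu) D (fun x => complex.Re (f x))
     - charge_integral (im_part mu) D (fun x => complex.Im (f x)))
  +i* (charge_integral (re_part mu) D (fun x => complex.Im (f x))
     + charge_integral (im_part mu) D (fun x => complex.Re (f x))).

End ComplexMeasures.

Section Henkin.
Variables (R : realType) (d : nat) (H : rkhs R (@unit_ball R d)).
Local Notation C := R[i].

Definition is_polynomial (f : multiplier H) (p : polynomial R d) : Prop :=
  forall z, f z = peval p (set_val z).

Definition henkin (mu : complex_measure R d) : Prop :=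
  sphere_measure mu /\
  exists phi : {linear multiplier H -> C},
    weak_star_continuous phi /\
    forall p, exists2 f : multiplier H, is_polynomial f p &
      phi f = cintegral mu (@unit_sphere R d) (peval p).

Definition totally_null (E : set (borel R d)) : Prop :=
  [/\ measurable E, E `<=` @unit_sphere R d &
      forall mu, henkin mu -> total_variation mu E = 0%E].

Definition ball_algebra : set (multiplier H) :=
  [set f | forall eps : R, 0 < eps ->
    exists p, exists2 q : multiplier H, is_polynomial q p &
      (mult_norm (f - q)%R < eps%:E)%E].

(* Such an F is determined by f on the closed ball, by density. *)
Definition continuous_extension (f : multiplier H) (F : 'rV[C]_d -> C) : Prop :=
  {within @closed_unit_ball R d, continuous F} /\ forall z, F (set_val z) = f z.

Definition interpolation_set (E : set 'rV[C]_d) : Prop :=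
  forall g : 'rV[C]_d -> C, {within E, continuous g} ->
    exists2 f, ball_algebra f &
      exists2 F, continuous_extension f F & forall z, E z -> F z = g z.

End Henkin.

(* Main.v *)
Require Import Defs.
From mathcomp Require Import all_boot all_order all_algebra.
From mathcomp Require Import complex.
From mathcomp Require Import all_classical all_reals all_analysis.
From mathcomp Require Import measurable_realfun.
From mathcomp Require Import ring lra.
From mathcomp Require Import (canonicals) mpoly.

(** Throughout, polynomials and multipliers are measured in the multiplier norm, which
    dominates the supremum norm on the closed ball.

    A finite set is an interpolation set because polynomials are multipliers and
    interpolate arbitrary values at finitely many points. That polynomials are
    multipliers follows from the existence of a single Henkin measure, and there are
    such measures: a point of the sphere is not totally null, so it is charged by a
    Henkin measure.

    Conversely, the point is that the evaluation at [w] depends on the point [w] of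
    the sphere continuously for the norm of functionals on polynomials
    ([henkin_point_modulus]). Let [mu] be a Henkin measure with an atom at [z], and
    let [q] be a polynomial that peaks at [z]. The functionals
    [p |-> \int p q^n dmu] converge in norm to a nonzero multiple of the
    evaluation at [z], since they do so for the supremum norm
    ([cintegral_peak]). Each of them is weak-star continuous, hence dominated by
    finitely many functionals [p |-> tr (M_p M_q^n A)] with [A] of trace class
    ([weak_star_bound]). The kernel being invariant under unitary maps, composition
    with a unitary map [U] preserves the multiplier norm ([mnorm_comp]), and
    [tr (M_(p o U) B) - tr (M_p B)] is small compared to the norm of [p] when [U] is
    close to the identity: approximating [B] by operators built from kernel vectors
    reduces this to the norm continuity of the kernel vectors
    ([inner_mulop_moves]). A unitary map that takes [z] to [w] and is close to the
    identity for [w] close to [z] ([move_point]) therefore transports the evaluation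
    at [z] to the one at [w] with a small error.

    So the distance [eval_dist z w] between the evaluations at [z] and [w] is
    continuous, and every [f] in the ball algebra satisfies
    [|f(w) - f(z)| <= eval_dist z w * ||f||]. If the square root of [eval_dist z]
    on the set [E] extends to such an [f], then [eval_dist z] has no small positive
    values on [E], and [z] is isolated in [E] ([interpolation_isolated]). A compact set
    all of whose points are isolated is finite.

    The trace is defined by a choice among nuclear expansions, so its independence
    of that choice is established first ([nuclear_trace_uniq]), as are the density of
    the span of the kernel vectors ([kcomb_dense]) and the boundedness of
    multiplication operators ([mulop_bounded]). *)

Import Order.TTheory GRing.Theory Num.Theory.
Import numFieldNormedType.Exports.
Local Open Scope classical_set_scope.
Local Open Scope ring_scope.
Local Open Scope complex_scope.
Set Implicit Arguments.
Unset Strict Implicit.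

(** * Norms over the complex numbers as real numbers *)

Section RealNorm.
Variables (R : realType) (V : normedModType R[i]).
Implicit Types (x y : V) (c : R[i]).

Lemma rnormE x : `|x| = (rnorm x)%:C.
Proof.
have := normr_ge0 x; rewrite /rnorm lecE; case: `|x| => a b /= /andP[/eqP -> _] //.
Qed.

Lemma rnorm_ge0 x : 0 <= rnorm x.
Proof. by have := normr_ge0 x; rewrite rnormE lecR. Qed.

Lemma rnorm0 : rnorm (0 : V) = 0.
Proof. by rewrite /rnorm normr0. Qed.

Lemma rnorm_eq0 x : rnorm x = 0 -> x = 0.
Proof. by move=> x0; apply/eqP; rewrite -normr_eq0 rnormE x0. Qed.

Lemma ler_rnormD x y : rnorm (x + y) <= rnorm x + rnorm y.
Proof. by have := ler_normD x y; rewrite !rnormE -rmorphD /= lecR. Qed.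

Lemma rnormN x : rnorm (- x) = rnorm x.
Proof. by rewrite /rnorm normrN. Qed.

Lemma rdistC x y : rnorm (x - y) = rnorm (y - x).
Proof. by rewrite -rnormN opprB. Qed.

Lemma ler_rnormB x y : rnorm (x - y) <= rnorm x + rnorm y.
Proof. by rewrite -[rnorm y]rnormN ler_rnormD. Qed.

Lemma ler_rdistD y x z : rnorm (x - z) <= rnorm (x - y) + rnorm (y - z).
Proof. by rewrite (le_trans _ (ler_rnormD _ _)) // addrA subrK. Qed.

Lemma rnormZ c x : rnorm (c *: x) = rnorm (c : R[i]^o) * rnorm x.
Proof.
by apply/(@complexI R); rewrite -rnormE normrZ rmorphM /= -!rnormE.
Qed.

(** Norms over [R[i]] take values in [R[i]], so that radii of balls are complex
    numbers too; this characterization lets every later estimate be made in [R],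
    where linear arithmetic applies. *)
Lemma cvg_rnormP (T : Type) (F : set_system T) {FF : Filter F} (f : T -> V) (l : V) :
  f @ F --> l <-> forall e : R, 0 < e -> \forall t \near F, rnorm (f t - l) < e.
Proof.
split=> [/cvgrPdist_lt fl e e0|fl].
  have := fl e%:C; rewrite ltcR => /(_ e0); apply: filterS => t.
  by rewrite distrC rnormE ltcR.
apply/cvgrPdist_lt => -[e b]; rewrite ltcE /= => /andP[/eqP -> /fl].
by apply: filterS => t; rewrite distrC rnormE ltcR.
Qed.

Lemma cvg_rnorm (T : Type) (F : set_system T) {FF : Filter F} (f : T -> V) (l : V) :
  f @ F --> l -> rnorm (f t) @[t --> F] --> rnorm l.
Proof.
move=> /cvg_rnormP fl; apply/cvgrPdist_lt => e /fl.
apply: filterS => t; apply: le_lt_trans.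
have h1 := ler_rnormD (f t - l) l; have h2 := ler_rnormD (l - f t) (f t).
rewrite subrK in h1; rewrite subrK rdistC in h2.
by rewrite ler_norml; lra.
Qed.

Lemma cvg_seq_unique (u : nat -> V) (l l' : V) :
  u @ \oo --> l -> u @ \oo --> l' -> l = l'.
Proof. exact: (cvg_unique (@norm_hausdorff _ V)). Qed.

End RealNorm.

Section ComplexNumbers.
Variable R : realType.
Implicit Types x y : R[i].

Lemma rnormM x y : rnorm (x * y) = rnorm x * rnorm y.
Proof. exact: (@rnormZ R R[i] x y). Qed.

Lemma rnormr (r : R) : rnorm (r%:C : R[i]) = `|r|.
Proof. by rewrite /rnorm normc_def /= expr0n addr0 sqrtr_sqr. Qed.

Lemma rdistr (a b : R) : rnorm (a%:C - b%:C : R[i]) = `|a - b|.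
Proof. by rewrite -(rmorphB (real_complex R)) rnormr. Qed.

Lemma rnorm_conj x : rnorm (Num.conj x) = rnorm x.
Proof. by rewrite /rnorm norm_conjC. Qed.

Lemma ler_Re_rnorm x : `|complex.Re x| <= rnorm x.
Proof. by rewrite /rnorm normc_def /= -sqrtr_sqr ler_wsqrtr // lerDl sqr_ge0. Qed.

Lemma ler_Im_rnorm x : `|complex.Im x| <= rnorm x.
Proof. by rewrite /rnorm normc_def /= -sqrtr_sqr ler_wsqrtr // lerDr sqr_ge0. Qed.

Lemma ler_rnorm_ReIm x : rnorm x <= `|complex.Re x| + `|complex.Im x|.
Proof.
rewrite /rnorm normc_def /= -[leRHS]ger0_norm ?addr_ge0 // -sqrtr_sqr ler_wsqrtr //.
rewrite -(real_normK (num_real (complex.Re x))) -(real_normK (num_real (complex.Im x))).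
have := normr_ge0 (complex.Re x); have := normr_ge0 (complex.Im x); nra.
Qed.

Lemma conjM x y : Num.conj (x * y) = Num.conj x * Num.conj y.
Proof. exact: rmorphM. Qed.

Lemma conjD x y : Num.conj (x + y) = Num.conj x + Num.conj y.
Proof. exact: rmorphD. Qed.

Lemma conjB x y : Num.conj (x - y) = Num.conj x - Num.conj y.
Proof. exact: rmorphB. Qed.

Lemma conjV x : Num.conj x^-1 = (Num.conj x)^-1.
Proof. exact: fmorphV. Qed.

Lemma conjr (r : R) : Num.conj (r%:C : R[i]) = r%:C.
Proof. by rewrite conj_Creal // complex_real. Qed.

Lemma rnorm1 : rnorm (1 : R[i]) = 1.
Proof. by rewrite /rnorm normr1. Qed.

Lemma rnormX x n : rnorm (x ^+ n) = rnorm x ^+ n.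
Proof. by elim: n => [|n IH]; rewrite ?rnorm1 // !exprS rnormM IH. Qed.

Lemma mul_conj_rnorm x : x * Num.conj x = (rnorm x ^+ 2)%:C.
Proof. by rewrite -normCK rnormE -rmorphXn. Qed.

End ComplexNumbers.

(** * Complete spaces and uniform boundedness *)

Section Complete.
Variables (R : realType) (V : completeNormedModType R[i]).

Lemma cauchy_rnorm (u : nat -> V) :
  (forall e : R, 0 < e -> exists N, forall m n, (N <= m)%N -> (N <= n)%N ->
    rnorm (u m - u n) < e) ->
  exists l : V, u @ \oo --> l.
Proof.
move=> uC; apply/cvg_ex; apply: cauchy_cvg; apply: cauchy_exP => -[e b].
rewrite ltcE /= => /andP[/eqP -> e0].
have [N uN] := uC _ e0; exists (u N); exists N => // n /= Nn.
by rewrite /= -ball_normE /ball_ /= rnormE ltcR; apply: uN => //=.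
Qed.

Lemma cvg_rnorm_le (u : nat -> V) (l y : V) (e : R) (N : nat) :
  u @ \oo --> l -> (forall n, (N <= n)%N -> rnorm (u n - y) <= e) ->
  rnorm (l - y) <= e.
Proof.
move=> ul uy; apply/ler_addgt0Pl => t t0.
have /cvg_rnormP/(_ _ t0)[M _ Ml] := ul.
rewrite (le_trans (ler_rdistD (u (maxn N M)) _ _)) // lerD ?uy ?leq_maxl //.
by rewrite rdistC ltW // Ml //= leq_maxr.
Qed.

(** The Baire argument in the form of nested balls. If the family had no common
    bound, then inside any ball around [x] of radius [d] one of [x + v], [x - v],
    with [v] of norm [d / 2] chosen so that [f v] is large, has a large image
    (because [f v] is half the difference of the images), and so has a small
    ball around it. The common point of the nested balls contradicts pointwise
    boundedness. *)
Lemma uniform_boundedness (W : normedModType R[i]) (F : set (V -> W)) :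
  (forall f, F f -> linear f /\ exists M : R, forall x, rnorm (f x) <= M * rnorm x) ->
  (forall x, exists M : R, forall f, F f -> rnorm (f x) <= M) ->
  exists M : R, forall f, F f -> forall x, rnorm (f x) <= M * rnorm x.
Proof.
move=> Flin Fpt; apply: contrapT => nub.
have {}nub : forall M : R, exists2 f, F f & exists x, M * rnorm x < rnorm (f x).
  move=> M; apply: contrapT => h; apply: nub; exists M => f Ff x.
  by rewrite leNgt; apply/negP => fx; apply: h; exists f => //; exists x.
pose P (n : nat) (b b' : V * R) := [/\ 0 < b'.2, rnorm (b'.1 - b.1) <= b.2 / 2,
  b'.2 <= b.2 / 2 &
  exists2 f, F f & forall y, rnorm (y - b'.1) <= b'.2 -> n%:R <= rnorm (f y)].
have step n b : 0 < b.2 -> exists b', P n b b'.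
  case: b => x d /= d0.
  have [f Ff [u fu]] := nub (n.+1%:R * 2 / d).
  have [flin [K fK]] := Flin f Ff.
  have f0 : f 0 = 0.
    have /(_ 1 0 0) := flin; rewrite !scale1r addr0 => /eqP.
    by rewrite -subr_eq subrr => /eqP.
  have fZ c v : f (c *: v) = c *: f v by have := flin c v 0; rewrite f0 !addr0.
  have fD v w : f (v + w) = f v + f w by have := flin 1 v w; rewrite !scale1r.
  have u0 : 0 < rnorm u.
    rewrite lt_neqAle rnorm_ge0 andbT; apply/eqP => u0; move: fu.
    by rewrite -u0 mulr0 (rnorm_eq0 (esym u0)) f0 rnorm0 ltxx.
  pose v := (d / 2 / rnorm u)%:C *: u.
  have nv : rnorm v = d / 2.
    rewrite rnormZ rnormr ger0_norm; last by rewrite !divr_ge0 // ltW.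
    by rewrite divfK ?gt_eqF.
  have fv : n.+1%:R < rnorm (f v).
    rewrite fZ rnormZ rnormr ger0_norm; last by rewrite !divr_ge0 // ltW.
    rewrite (_ : n.+1%:R = d / 2 / rnorm u * (n.+1%:R * 2 / d * rnorm u)); last first.
      by field; rewrite ?gt_eqF.
    by rewrite ltr_pM2l // !divr_gt0.
  have [w nw fw] : exists2 w, rnorm (w - x) = d / 2 & n.+1%:R < rnorm (f w).
    have [h|h] := ltP n.+1%:R (rnorm (f (x + v))).
      by exists (x + v) => //; rewrite addrC addKr.
    exists (x - v); first by rewrite addrC addKr rnormN.
    have fN : f (x - v) = f (x + v) - 2%:R *: f v.
      by rewrite -scaleN1r !fD fZ scaleN1r scaler_nat mulr2n opprD addrA addrK.
    have := ler_rnormB (f (x + v)) (f (x - v)).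
    rewrite {1}fN opprB addrCA subrr addr0.
    rewrite rnormZ (_ : 2%:R = (2%:R)%:C :> R[i]); last by rewrite rmorph_nat.
    rewrite rnormr ger0_norm //.
    by move: fv h; lra.
  have K0 : 0 < `|K| + 1 by rewrite ltr_wpDl.
  (* On a ball of radius at most 1 / (|K| + 1) the values of f vary by at most 1. *)
  exists (w, Num.min (d / 2) (`|K| + 1)^-1); split => /=.
  - by rewrite lt_min invr_gt0 K0 divr_gt0.
  - by rewrite nw.
  - by rewrite ge_min lexx.
  - exists f => // y; rewrite le_min => /andP[_ yw].
    have : rnorm (f (w - y)) <= 1.
      have := fK (w - y); rewrite -(ler_pM2l K0) divff ?gt_eqF // rdistC in yw.
      by have := ler_norm K; have := rnorm_ge0 (w - y); nra.
    have -> : f y = f w - f (w - y).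
      rewrite fD -[- y]scaleN1r fZ scaleN1r opprB addrC subrK //.
    have := ler_rnormD (f w - f (w - y)) (f (w - y)); rewrite subrK.
    by move: fw; rewrite -natr1; lra.
have [g gP] : exists g : nat -> V * R -> V * R, forall n b, 0 < b.2 -> P n b (g n b).
  have /choice[g gP] : forall nb : nat * (V * R), exists b',
      0 < nb.2.2 -> P nb.1 nb.2 b'.
    move=> [n b] /=; have [/(step n)[b' Pb']|_] := boolP (0 < b.2); last by exists b.
    by exists b'.
  by exists (fun n b => g (n, b)) => n b; exact: (gP (n, b)).
pose s := fix s n := if n is m.+1 then g m (s m) else (0 : V, 1 : R).
have s0 n : 0 < (s n).2 by elim: n => //= n IH; case: (gP n _ IH).
have sP n : P n (s n) (s n.+1) by exact: gP.
have nest n k : rnorm ((s (n + k)%N).1 - (s n).1) + (s (n + k)%N).2 <= (s n).2.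
  elim: k => [|k IH]; first by rewrite addn0 subrr rnorm0 add0r.
  rewrite addnS; have [_ h1 h2 _] := sP (n + k)%N.
  have := ler_rdistD (s (n + k)%N).1 (s (n + k).+1).1 (s n).1; lra.
have small n : (s n).2 <= 2^-1 ^+ n.
  elim: n => [|n IH]; first by rewrite expr0.
  have [_ _ h _] := sP n; rewrite (le_trans h) // exprSr ler_pM2r //.
have near_s n m : (n <= m)%N -> rnorm ((s m).1 - (s n).1) <= (s n).2.
  by move=> nm; have := nest n (m - n)%N; rewrite subnKC //; have := s0 m; lra.
have [l sl] : exists l : V, (fun n => (s n).1) @ \oo --> l.
  apply: cauchy_rnorm => e e0.
  have /cvgrPdist_lt/(_ (e / 2)) : (fun n => 2^-1 ^+ n : R) @ \oo --> (0 : R).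
    by apply: cvg_expr; rewrite gtr0_norm; lra.
  case=> [|N _ NP]; first by lra.
  exists N => m n Nm Nn.
  have := NP N (leqnn N); rewrite sub0r normrN ger0_norm ?exprn_ge0 // => h.
  have := ler_rdistD (s N).1 (s m).1 (s n).1; rewrite (rdistC (s N).1).
  have := near_s _ _ Nm; have := near_s _ _ Nn; have := small N; lra.
have [M MP] := Fpt l.
have [f Ff fP] : exists2 f, F f & (Num.truncn M).+1%:R <= rnorm (f l).
  have [_ _ _ [f Ff fP]] := sP (Num.truncn M).+1; exists f => //; apply: fP.
  exact: (cvg_rnorm_le sl (near_s _)).
have := MP f Ff; have := truncnS_gt M; lra.
Qed.

End Complete.

(** * Geometry of the Hilbert space *)

Section InnerProduct.
Variables (R : realType) (X : Type) (H : rkhs R X).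
Implicit Types (u v h : H) (c : R[i]).

Lemma innerC u v : inner H v u = Num.conj (inner H u v).
Proof. by rewrite hermC mul1r. Qed.

Lemma innerDl u v h : inner H (u + v) h = inner H u h + inner H v h.
Proof. exact: linearDl. Qed.
Lemma innerZl c u h : inner H (c *: u) h = c * inner H u h.
Proof. exact: linearZl_LR. Qed.
Lemma innerDr u v h : inner H h (u + v) = inner H h u + inner H h v.
Proof. exact: linearDr. Qed.
Lemma innerZr c u h : inner H h (c *: u) = Num.conj c * inner H h u.
Proof. exact: linearZr_LR. Qed.
Lemma inner0l h : inner H 0 h = 0. Proof. exact: linear0l. Qed.
Lemma inner0r h : inner H h 0 = 0. Proof. exact: linear0r. Qed.
Lemma innerBl u v h : inner H (u - v) h = inner H u h - inner H v h.
Proof. exact: linearBl. Qed.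
Lemma innerBr u v h : inner H h (u - v) = inner H h u - inner H h v.
Proof. exact: linearBr. Qed.
Lemma inner_suml (I : Type) (s : seq I) (P : pred I) (F : I -> H) h :
  inner H (\sum_(i <- s | P i) F i) h = \sum_(i <- s | P i) inner H (F i) h.
Proof. by elim/big_rec2: _ => [|i a b _ <-]; rewrite ?inner0l ?innerDl. Qed.
Lemma inner_sumr (I : Type) (s : seq I) (P : pred I) (F : I -> H) h :
  inner H h (\sum_(i <- s | P i) F i) = \sum_(i <- s | P i) inner H h (F i).
Proof. by elim/big_rec2: _ => [|i a b _ <-]; rewrite ?inner0r ?innerDr. Qed.

Lemma innerE u : inner H u u = (rnorm u ^+ 2)%:C.
Proof. by rewrite inner_norm rnormE -rmorphXn. Qed.

Lemma rnorm_subZ u v c :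
  rnorm (u - c *: v) ^+ 2 = rnorm u ^+ 2
    - 2 * complex.Re (Num.conj c * inner H u v) + rnorm c ^+ 2 * rnorm v ^+ 2.
Proof.
have ReE (x : R[i]) : (2 * complex.Re x)%:C = x + Num.conj x.
  case: x => x y; apply/eqP; rewrite eq_complex /= addrN.
  by apply/andP; split; apply/eqP => //; ring.
apply: (@complexI R); rewrite -innerE innerBl !innerBr !innerZl !innerZr !innerE (innerC u v).
rewrite rmorphD rmorphB (rmorphM _ (rnorm c ^+ 2)) /= -mul_conj_rnorm ReE conjM conjCK.
by ring.
Qed.

Lemma rnorm_parallelogram u v :
  rnorm (u + v) ^+ 2 + rnorm (u - v) ^+ 2 = 2 * (rnorm u ^+ 2 + rnorm v ^+ 2).
Proof.
have := rnorm_subZ u v 1; have := rnorm_subZ u v (-1).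
have -> : Num.conj (- 1 : R[i]) = - 1 by exact: (rmorphN1 Num.conj).
have -> : Num.conj (1 : R[i]) = 1 by exact: (rmorph1 Num.conj).
rewrite !scaleN1r !scale1r opprK !mulN1r !mul1r rnormN rnorm1.
by rewrite (_ : complex.Re (- _) = - complex.Re (inner H u v)); [lra|case: (inner H u v)].
Qed.

(** Subtracting from [u] its projection onto the line of [v]; the Cauchy-Schwarz
    inequality and the orthogonality of nearest points both read off this value. *)
Lemma rnorm_sub_proj u v : rnorm v != 0 ->
  rnorm (u - (inner H u v * ((rnorm v ^+ 2)^-1)%:C) *: v) ^+ 2 =
  rnorm u ^+ 2 - rnorm (inner H u v) ^+ 2 / rnorm v ^+ 2.
Proof.
move=> v0; rewrite rnorm_subZ; set a := inner H u v.
have -> : Num.conj (a * ((rnorm v ^+ 2)^-1)%:C) * a = (rnorm a ^+ 2 / rnorm v ^+ 2)%:C.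
  by rewrite conjM conjr mulrAC (mulrC (Num.conj a)) mul_conj_rnorm -rmorphM.
by rewrite rnormM rnormr ger0_norm ?invr_ge0 ?sqr_ge0 //=; field.
Qed.

Lemma cauchy_schwarz u v : rnorm (inner H u v) <= rnorm u * rnorm v.
Proof.
have [v0|v0] := eqVneq (rnorm v) 0.
  by rewrite (rnorm_eq0 v0) inner0r !rnorm0 mulr0.
have vp : 0 < rnorm v by rewrite lt_neqAle eq_sym v0 rnorm_ge0.
rewrite -ler_sqr ?nnegrE ?mulr_ge0 ?rnorm_ge0 // exprMn -ler_pdivrMr ?exprn_gt0 //.
by rewrite -subr_ge0 -rnorm_sub_proj // sqr_ge0.
Qed.

(** The projection theorem. A minimizing sequence for the distance from [h] to
    the subspace [S] is Cauchy by the parallelogram identity; for its limit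
    [l], no multiple of an element of [S] brings [h - l] closer to [0], so that
    [h - l] is orthogonal to [S], hence zero. *)
Lemma dense_of_orthogonal_eq0 (S : set H) :
  S 0 -> (forall c u v, S u -> S v -> S (c *: u + v)) ->
  (forall h, (forall s, S s -> inner H h s = 0) -> h = 0) ->
  forall h (e : R), 0 < e -> exists2 s, S s & rnorm (h - s) < e.
Proof.
move=> S0 Slin Sorth h e e0.
pose D := [set rnorm (h - s) ^+ 2 | s in S].
have Dinf : has_inf D.
  split; first by exists (rnorm (h - 0) ^+ 2), 0.
  by exists 0 => _ [s _ <-]; exact: sqr_ge0.
have Dle s : S s -> inf D <= rnorm (h - s) ^+ 2.
  by move=> Ss; apply: ge_inf; [case: Dinf | exists s].
have /choice[s sP] : forall n : nat, exists s, S s /\ rnorm (h - s) ^+ 2 < inf D + n.+1%:R^-1.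
  move=> n; have n0 : 0 < n.+1%:R^-1 :> R by [].
  have [_ [s Ss <-] sn] := inf_adherent n0 Dinf.
  by exists s.
have hmid u v : S u -> S v ->
    rnorm (u - v) ^+ 2 <= 2 * rnorm (h - u) ^+ 2 + 2 * rnorm (h - v) ^+ 2 - 4 * inf D.
  move=> Su Sv; have := rnorm_parallelogram (h - u) (h - v).
  rewrite (_ : h - u - (h - v) = v - u); last by rewrite opprB addrC addrA subrK.
  have Sm : S ((2^-1)%:C *: (u + v)).
    rewrite -[_ *: _]addr0; apply: (Slin) => //; rewrite -[u]scale1r; exact: (Slin).
  have -> : h - u + (h - v) = 2%:C *: (h - (2^-1)%:C *: (u + v)).
    rewrite scalerBr scalerA -rmorphM divff // scale1r rmorph_nat scaler_nat mulr2n.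
    by rewrite addrACA opprD.
  rewrite rnormZ rnormr ger0_norm // (rdistC v).
  have := Dle _ Sm; set A := rnorm (h - _ *: _); set B := rnorm (u - v); nra.
have [l sl] : exists l : H, s @ \oo --> l.
  apply: cauchy_rnorm => t t0.
  have t40 : 0 < t ^+ 2 / 4 by rewrite divr_gt0 // exprn_gt0.
  have [N _ NP] := near_infty_natSinv_lt (PosNum t40).
  exists N => m n Nm Nn; rewrite -ltr_sqr ?nnegrE ?rnorm_ge0 ?ltW //.
  have [Sm sm] := sP m; have [Sn sn] := sP n.
  have := hmid _ _ Sm Sn; have /= := NP m Nm; have /= := NP n Nn.
  move: sm sn; move: (m.+1%:R^-1) (n.+1%:R^-1) => p q; lra.
suff hl : h = l.
  by have /cvg_rnormP/(_ _ e0)[N _ /(_ N (leqnn N)) /= +] := sl;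
     rewrite hl rdistC; exists (s N) => //; case: (sP N).
pose d := Num.sqrt (inf D).
have D0 : 0 <= inf D by apply: lb_le_inf; [case: Dinf | move=> _ [u _ <-]; exact: sqr_ge0].
have d2 : d ^+ 2 = inf D by rewrite sqr_sqrtr.
have d0 : 0 <= d by exact: sqrtr_ge0.
have sd (t : R) : 0 < t -> exists n, rnorm (h - s n) < d + t /\ rnorm (s n - l) < t.
  move=> t0; have /cvg_rnormP/(_ _ t0)[N _ NP] := sl.
  have [M _ MP] := near_infty_natSinv_lt (PosNum (exprn_gt0 2 t0)).
  exists (maxn N M); split; last by apply: NP; rewrite /= leq_maxl.
  have /= := MP _ (leq_maxr N M); have [_] := sP (maxn N M).
  rewrite -[_ < d + t]ltr_sqr ?nnegrE ?rnorm_ge0 ?addr_ge0 // ?ltW //.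
  by rewrite -d2; move: (_%:R^-1) => p; have := mulr_ge0 d0 (ltW t0); nra.
have hl : rnorm (h - l) <= d.
  apply/ler_addgt0Pl => t t0; have [n []] := sd (t / 2) (divr_gt0 t0 (ltr0n _ 2)).
  by have := ler_rdistD (s n) h l; lra.
have key c u : S u -> d <= rnorm (h - l - c *: u).
  move=> Su; apply/ler_addgt0Pl => t t0; have [n [_ sn]] := sd t t0.
  have : d <= rnorm (h - (c *: u + s n)).
    rewrite -ler_sqr ?nnegrE ?rnorm_ge0 // d2; apply: Dle.
    by apply: (Slin) => //; case: (sP n).
  have E : h - (c *: u + s n) = (h - l - c *: u) - (s n - l).
    by rewrite (opprB (s n)) addrACA subrK -opprD.
  by rewrite E; have := ler_rnormB (h - l - c *: u) (s n - l); lra.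
apply: subr0_eq; apply: (Sorth) => u Su; apply: rnorm_eq0.
have [u0|u0] := eqVneq (rnorm u) 0; first by rewrite (rnorm_eq0 u0) inner0r rnorm0.
have up : 0 < rnorm u ^+ 2 by rewrite exprn_gt0 // lt_neqAle eq_sym u0 rnorm_ge0.
have := key (inner H (h - l) u * ((rnorm u ^+ 2)^-1)%:C) u Su.
move/(le_trans hl); rewrite -ler_sqr ?nnegrE ?rnorm_ge0 // rnorm_sub_proj //.
rewrite lerBrDr gerDl ler_pdivrMr // mul0r => h0.
by apply/eqP; rewrite -sqrf_eq0 eq_le h0 sqr_ge0.
Qed.

Definition kcomb (s : seq (R[i] * X)) : H := \sum_(p <- s) p.1 *: kvec H p.2.

(** By the reproducing property a vector orthogonal to all kernel vectors is the
    zero function. *)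
Lemma kcomb_dense h (e : R) : 0 < e -> exists s, rnorm (h - kcomb s) < e.
Proof.
move=> e0; have [|c u v|g gorth|_ [s _ <-]] :=
    @dense_of_orthogonal_eq0 (range kcomb) _ _ _ h e e0; last by exists s.
- by exists [::] => //; rewrite /kcomb big_nil.
- move=> [s _ <-] [t _ <-]; exists ([seq (c * p.1, p.2) | p <- s] ++ t) => //.
  rewrite /kcomb big_cat big_map /= scaler_sumr; congr (_ + _).
  by apply: eq_bigr => p _; rewrite scalerA.
- apply: (@fval_inj _ _ H); apply/funext => x; rewrite raddf0 reproducing.
  by have := gorth (kvec H x); apply; exists [:: (1, x)] => //; rewrite /kcomb big_seq1 scale1r.
Qed.

End InnerProduct.

(** * Multipliers and the kernel criterion for their norm *)

Section Multipliers.
Variables (R : realType) (X : Type) (H : rkhs R X).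
Implicit Types (f g : multiplier H) (u v h : H) (c : R[i]) (s : seq (R[i] * X)).

Lemma mulopE f h : fval H (mulop f h) = Defs.mfun f * fval H h.
Proof.
have /asboolP/(_ h)[g gP] := Defs.mfunP f.
by rewrite /mulop; apply: (@xgetPex _ 0 [set g : H | fval H g = Defs.mfun f * fval H h]); exists g.
Qed.

Lemma mulopxE f h x : fval H (mulop f h) x = f x * fval H h x.
Proof. by rewrite mulopE. Qed.

Lemma mulopP f h u : fval H u = Defs.mfun f * fval H h -> mulop f h = u.
Proof. by move=> uE; apply: (@fval_inj _ _ H); rewrite mulopE uE. Qed.

Lemma mulopZD f c u v : mulop f (c *: u + v) = c *: mulop f u + mulop f v.
Proof.
apply: mulopP; rewrite !linearP !mulopE; apply/funext => x.
by rewrite !fctE mulrDr; congr (_ + _); rewrite /GRing.scale /= mulrCA.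
Qed.

Lemma mulopB f g h : mulop (f - g) h = mulop f h - mulop g h.
Proof.
have fgE : Defs.mfun (f - g) = Defs.mfun f - Defs.mfun g.
  exact: (raddfB (\val : multiplier H -> _)).
by apply: mulopP; rewrite fgE linearB !mulopE mulrBl.
Qed.

Lemma mulop_mul f g k h : Defs.mfun k = Defs.mfun f * Defs.mfun g ->
  mulop k h = mulop f (mulop g h).
Proof. by move=> kE; apply: mulopP; rewrite kE !mulopE mulrA. Qed.

Lemma inner_kcomb h s :
  inner H h (kcomb H s) = \sum_(p <- s) Num.conj p.1 * fval H h p.2.
Proof.
by rewrite inner_sumr; apply: eq_bigr => p _; rewrite innerZr reproducing.
Qed.

(** The coefficients of the image of [kcomb s] under the adjoint of
    multiplication by [f], whose eigenvectors are the kernel vectors: it sends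
    [kvec w] to [kvec w] times the conjugate of [f w]. Working with it on
    combinations of kernel vectors dispenses with adjoints of operators. *)
Definition adj_comb (f : X -> R[i]) s := [seq (Num.conj (f p.2) * p.1, p.2) | p <- s].

Lemma inner_mulop_kcomb f h s :
  inner H (mulop f h) (kcomb H s) = inner H h (kcomb H (adj_comb f s)).
Proof.
rewrite !inner_kcomb big_map; apply: eq_bigr => p _ /=.
by rewrite mulopxE conjM conjCK mulrCA mulrA.
Qed.

(** A norm is attained by duality against a dense subspace. *)
Lemma rnorm_le_kcomb h (A : R) : 0 <= A ->
  (forall s, rnorm (inner H h (kcomb H s)) <= A * rnorm (kcomb H s)) -> rnorm h <= A.
Proof.
move=> A0 hA; have [h0|h0] := eqVneq (rnorm h) 0; first by rewrite h0.
have hp : 0 < rnorm h by rewrite lt_neqAle eq_sym h0 rnorm_ge0.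
suff : rnorm h * rnorm h <= A * rnorm h by rewrite ler_pM2r.
apply/ler_addgt0Pl => e e0.
have d0 : 0 < e / (rnorm h + A) by rewrite divr_gt0 // ltr_wpDr.
have [s sh] := kcomb_dense h d0.
have hk : rnorm (kcomb H s) <= rnorm h + e / (rnorm h + A).
  have := ler_rdistD h (kcomb H s) 0; rewrite !subr0 (rdistC _ h); lra.
have -> : rnorm h * rnorm h = rnorm (inner H h h).
  by rewrite innerE rnormr ger0_norm ?sqr_ge0.
rewrite -{2}[h](subrK (kcomb H s)) innerDr.
apply: le_trans (ler_rnormD _ _) _.
have h1 := cauchy_schwarz h (h - kcomb H s); have h2 := hA s.
have h3 : rnorm h * rnorm (h - kcomb H s) <= rnorm h * (e / (rnorm h + A)).
  by rewrite ler_pM2l // ltW.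
have h4 : A * rnorm (kcomb H s) <= A * (rnorm h + e / (rnorm h + A)).
  by rewrite ler_wpM2l.
have -> : e = rnorm h * (e / (rnorm h + A)) + A * (e / (rnorm h + A)).
  by field; rewrite gt_eqF // ltr_wpDr.
rewrite mulrDr in h4; lra.
Qed.

(** A multiplier is only assumed to map the space to itself; boundedness is the
    uniform boundedness principle for the functionals [h |-> <f h, k>], [k] a
    normalized combination of kernel vectors. Each of them is bounded since
    [<f h, k>] is the inner product of [h] with a vector that depends on [k] only,
    and pointwise they are bounded by the norm of [f h]. *)
Lemma mulop_bounded f : exists M : R, forall h, rnorm (mulop f h) <= M * rnorm h.
Proof.
pose F : set (H -> R[i]) :=
  [set (fun h => ((rnorm (kcomb H s))^-1)%:C * inner H (mulop f h) (kcomb H s)) |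
     s in [set: seq (R[i] * X)]].
have nF s h : rnorm (((rnorm (kcomb H s))^-1)%:C * inner H (mulop f h) (kcomb H s)) =
    (rnorm (kcomb H s))^-1 * rnorm (inner H (mulop f h) (kcomb H s)).
  by rewrite rnormM rnormr ger0_norm // invr_ge0 rnorm_ge0.
have invle (a b c : R) : 0 <= a -> 0 <= b -> c <= a * b -> a^-1 * c <= b.
  rewrite le_eqVlt => /predU1P[<- b0 _|a0 b0 cab]; first by rewrite invr0 mul0r.
  by rewrite mulrC ler_pdivrMr // mulrC.
have [|h|M FM] := @uniform_boundedness _ _ _ F.
- move=> _ [s _ <-]; split.
    move=> c u v; rewrite mulopZD innerDl innerZl mulrDr; congr (_ + _).
    by rewrite /GRing.scale /= mulrCA.
  exists ((rnorm (kcomb H s))^-1 * rnorm (kcomb H (adj_comb f s))) => h.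
  rewrite nF -mulrA ler_wpM2l ?invr_ge0 ?rnorm_ge0 // inner_mulop_kcomb mulrC.
  exact: cauchy_schwarz.
- exists (rnorm (mulop f h)) => _ [s _ <-]; rewrite nF; apply: invle; rewrite ?rnorm_ge0 // mulrC.
  exact: cauchy_schwarz.
exists `|M| => h; apply: rnorm_le_kcomb => [|s]; first by rewrite mulr_ge0 ?rnorm_ge0.
have [k0|k0] := eqVneq (rnorm (kcomb H s)) 0.
  by rewrite (rnorm_eq0 k0) inner0r !rnorm0 mulr0.
have kp : 0 < rnorm (kcomb H s) by rewrite lt_neqAle eq_sym k0 rnorm_ge0.
have := FM _ (ex_intro2 _ _ s I erefl) h; rewrite nF mulrC ler_pdivrMr // => /le_trans; apply.
by rewrite !ler_wpM2r ?rnorm_ge0 // ler_norm.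
Qed.

Definition mnorm f : R := fine (mult_norm f).

Lemma mem_opnorm_set f h : rnorm h <= 1 ->
  [set (rnorm (mulop f h))%:E | h in [set h : H | `|h| <= 1]] (rnorm (mulop f h))%:E.
Proof. by move=> h1; exists h => //=; rewrite rnormE -[1](rmorph1 (real_complex R)) lecR. Qed.

Lemma mult_norm_le f (M : R) : 0 <= M ->
  (forall h, rnorm (mulop f h) <= M * rnorm h) -> (mult_norm f <= M%:E)%E.
Proof.
move=> M0 fM; apply: ge_ereal_sup => _ [h /= h1 <-]; rewrite lee_fin.
move: h1; rewrite rnormE -[1](rmorph1 (real_complex R)) lecR => h1.
by rewrite (le_trans (fM h)) // ler_piMr.
Qed.

Lemma mult_norm_ge0 f : (0 <= mult_norm f)%E.
Proof.
have h : rnorm (0 : H) <= 1 by rewrite rnorm0.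
apply: le_trans (ereal_sup_ubound (mem_opnorm_set f h)).
by rewrite lee_fin rnorm_ge0.
Qed.

Lemma mnormE f : mult_norm f = (mnorm f)%:E.
Proof.
have [M fM] := mulop_bounded f.
have : (mult_norm f <= `|M|%:E)%E.
  apply: mult_norm_le => // h; apply: le_trans (fM h) _.
  by rewrite ler_wpM2r ?rnorm_ge0 // ler_norm.
move=> /le_lt_trans/(_ (ltry _)) fy; rewrite /mnorm fineK //.
by rewrite ge0_fin_numE // mult_norm_ge0.
Qed.

Lemma mnorm_ge0 f : 0 <= mnorm f.
Proof. by rewrite -lee_fin -mnormE mult_norm_ge0. Qed.

Lemma mnorm_le f (M : R) : 0 <= M ->
  (forall h, rnorm (mulop f h) <= M * rnorm h) -> mnorm f <= M.
Proof. by move=> M0 fM; rewrite -lee_fin -mnormE mult_norm_le. Qed.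

Lemma rnorm_mulop f h : rnorm (mulop f h) <= mnorm f * rnorm h.
Proof.
have [h0|h0] := eqVneq (rnorm h) 0.
  rewrite h0 mulr0; have -> : mulop f h = 0; last by rewrite rnorm0.
  by apply: mulopP; rewrite (rnorm_eq0 h0) !raddf0 mulr0.
have hp : 0 < rnorm h by rewrite lt_neqAle eq_sym h0 rnorm_ge0.
have nh : rnorm ((rnorm h)^-1%:C *: h) <= 1.
  by rewrite rnormZ rnormr ger0_norm ?invr_ge0 ?rnorm_ge0 // mulVf.
have := ereal_sup_ubound (mem_opnorm_set f nh); rewrite -/(opnorm _) -/(mult_norm f) mnormE lee_fin.
have -> : mulop f ((rnorm h)^-1%:C *: h) = (rnorm h)^-1%:C *: mulop f h.
  rewrite -[_ *: h]addr0 mulopZD (_ : mulop f 0 = 0) ?addr0 //.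
  by apply: mulopP; rewrite !raddf0 mulr0.
rewrite rnormZ rnormr ger0_norm ?invr_ge0 ?rnorm_ge0 // mulrC.
by rewrite ler_pdivrMr.
Qed.

Lemma mnormB f g : mnorm (f - g) <= mnorm f + mnorm g.
Proof.
apply: mnorm_le => [|h]; first by rewrite addr_ge0 ?mnorm_ge0.
by rewrite mulopB mulrDl (le_trans (ler_rnormB _ _)) // lerD ?rnorm_mulop.
Qed.

(** Together with [mnorm_le_adj_comb], this expresses the norm of a multiplier
    through the Gram matrices of kernel vectors, which is what makes the norm
    invariant under symmetries of the kernel. *)
Lemma rnorm_adj_comb f s : rnorm (kcomb H (adj_comb f s)) <= mnorm f * rnorm (kcomb H s).
Proof.
set u := kcomb H (adj_comb f s); have [u0|u0] := eqVneq (rnorm u) 0.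
  by rewrite u0 mulr_ge0 ?mnorm_ge0 ?rnorm_ge0.
have up : 0 < rnorm u by rewrite lt_neqAle eq_sym u0 rnorm_ge0.
rewrite -(ler_pM2r up) (_ : rnorm u * rnorm u = rnorm (inner H u u)); last first.
  by rewrite innerE rnormr ger0_norm ?sqr_ge0.
rewrite -inner_mulop_kcomb (le_trans (cauchy_schwarz _ _)) //.
by rewrite mulrAC ler_wpM2r ?rnorm_ge0 ?rnorm_mulop.
Qed.

Lemma mnorm_le_adj_comb f (M : R) : 0 <= M ->
  (forall s, rnorm (kcomb H (adj_comb f s)) <= M * rnorm (kcomb H s)) -> mnorm f <= M.
Proof.
move=> M0 fM; apply: mnorm_le => // h; apply: rnorm_le_kcomb => [|s].
  by rewrite mulr_ge0 ?rnorm_ge0.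
rewrite inner_mulop_kcomb (le_trans (cauchy_schwarz _ _)) //.
by rewrite [leRHS]mulrAC mulrC ler_wpM2r ?rnorm_ge0.
Qed.

Section Constants.
Variable (e : H).
Hypothesis eE : fval H e = 1.

(** The value at [x] is the conjugate of an eigenvalue of the adjoint, with
    eigenvector [kvec x]; this vector is nonzero because the constant [1]
    belongs to the space. *)
Lemma rnorm_multiplier f x : rnorm (f x) <= mnorm f.
Proof.
have kp : 0 < rnorm (kvec H x).
  rewrite lt_neqAle eq_sym rnorm_ge0 andbT; apply/eqP => k0.
  have := reproducing e x; rewrite eE (rnorm_eq0 k0) inner0r => /eqP.
  by rewrite oner_eq0.
have := rnorm_adj_comb f [:: (1, x)].
rewrite /kcomb /adj_comb /= !big_seq1 /= mulr1 scale1r rnormZ.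
by rewrite ler_pM2r // rnorm_conj.
Qed.

(** [f x] is the inner product of [f e] with [kvec x], where [e] is the constant [1]. *)
Lemma rnorm_multiplierB f x y :
  rnorm (f x - f y) <= mnorm f * rnorm e * rnorm (kvec H x - kvec H y).
Proof.
have fE z : f z = inner H (mulop f e) (kvec H z).
  by rewrite -reproducing mulopxE eE mulr1.
rewrite !fE -innerBr (le_trans (cauchy_schwarz _ _)) //.
by rewrite ler_wpM2r ?rnorm_ge0 ?rnorm_mulop.
Qed.
End Constants.

End Multipliers.

(** * The trace of a nuclear operator *)

Section ComplexSeries.
Variable R : realType.

Lemma abs_series_cvg (u : nat -> R[i]) :
  cvgn (series (fun n => rnorm (u n))) -> exists t : R[i], series u @ \oo --> t.
Proof.
move=> uc.
have part (p : R[i] -> R) : (forall x, `|p x| <= rnorm x) ->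
    exists t : R, series (p \o u) @ \oo --> t.
  move=> pn; apply/cvg_ex; apply: normed_cvg.
  apply: (series_le_cvg _ _ _ uc) => n /=; [exact: normr_ge0|exact: rnorm_ge0|exact: pn].
have [a ra] := part _ (@ler_Re_rnorm R); have [b ib] := part _ (@ler_Im_rnorm R).
have sE n : series u n = (series (@complex.Re R \o u) n) +i* (series (@complex.Im R \o u) n).
  rewrite /series /=; elim: n => [|n IH]; first by rewrite !big_geq.
  by rewrite !big_nat_recr //= IH; case: (u n).
exists (a +i* b); apply/cvg_rnormP => e e0.
have e20 : 0 < e / 2 by rewrite divr_gt0.
move/cvgrPdist_lt : ra => /(_ _ e20) ra; move/cvgrPdist_lt : ib => /(_ _ e20) ib.
apply: filterS2 ra ib => n; rewrite sE distrC => h1; rewrite distrC => h2.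
by apply: le_lt_trans (ler_rnorm_ReIm _) _; rewrite /=; lra.
Qed.

End ComplexSeries.

Section Trace.
Variables (R : realType) (X : Type) (H : rkhs R X).
Implicit Types (u v h : H) (c : R[i]) (A : H -> H) (x y : nat -> H).

(** The orthogonal projection onto the span of [es] when [es] is orthonormal. *)
Definition oproj (es : seq H) h : H := \sum_(e <- es) inner H h e *: e.

Lemma oprojZD es c u v : oproj es (c *: u + v) = c *: oproj es u + oproj es v.
Proof.
rewrite /oproj scaler_sumr -big_split; apply: eq_bigr => e _.
by rewrite innerDl innerZl scalerDl scalerA.
Qed.

Lemma inner_oproj es u v : inner H (oproj es u) v = inner H u (oproj es v).
Proof.
rewrite inner_suml inner_sumr; apply: eq_bigr => e _.
by rewrite innerZl innerZr -innerC mulrC.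
Qed.

Lemma oprojB es u v : oproj es (u - v) = oproj es u - oproj es v.
Proof. by rewrite addrC -scaleN1r oprojZD scaleN1r addrC. Qed.

(** The Gram-Schmidt process. Of the orthonormality of [es] only the idempotence of
    the projection is kept. *)
Lemma oproj_ex (xs : seq H) : exists es : seq H,
  (forall h, h \in xs -> oproj es h = h) /\
  (forall h, oproj es (oproj es h) = oproj es h).
Proof.
elim: xs => [|x xs [es [esx esP]]].
  by exists [::]; split=> // h; rewrite /oproj !big_nil.
pose r := x - oproj es x.
have Pr : oproj es r = 0 by rewrite oprojB esP subrr.
have [r0|r0] := eqVneq r 0.
  exists es; split=> // h; rewrite inE => /predU1P[->|/esx//].
  by apply/esym/subr0_eq.
have rp : 0 < rnorm r.
  by rewrite lt_neqAle eq_sym rnorm_ge0 andbT; apply: contra_neq r0 => /rnorm_eq0.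
pose e := (rnorm r)^-1%:C *: r.
have Pe : oproj es e = 0.
  by rewrite /e -[_ *: r]addr0 oprojZD Pr scaler0 add0r -[0 as X in oproj _ X]Pr esP Pr.
have ee : inner H e e = 1.
  rewrite innerE rnormZ rnormr ger0_norm ?invr_ge0 ?rnorm_ge0 // mulVf ?gt_eqF //.
  by rewrite expr1n.
have Phe h : inner H (oproj es h) e = 0 by rewrite inner_oproj Pe inner0r.
have PE h : oproj (e :: es) h = inner H h e *: e + oproj es h by rewrite /oproj big_cons.
exists (e :: es); split=> [h|h].
  rewrite inE PE => /predU1P[->|/esx hE]; last first.
    by rewrite -{1}hE Phe scale0r add0r hE.
  have -> : inner H x e = inner H r e by rewrite innerBl Phe subr0.
  rewrite /e innerZr innerE conjr -rmorphM scalerA -rmorphM.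
  rewrite (_ : _ * _ = 1 :> R) ?scale1r ?subrK //.
  by field; rewrite gt_eqF.
by rewrite !PE oprojZD Pe scaler0 add0r esP innerDl innerZl ee mulr1 Phe addr0.
Qed.

Lemma rnorm_oproj es h : (forall h, oproj es (oproj es h) = oproj es h) ->
  rnorm (oproj es h) <= rnorm h.
Proof.
move=> esP; have [p0|p0] := eqVneq (rnorm (oproj es h)) 0; first by rewrite p0 rnorm_ge0.
have pp : 0 < rnorm (oproj es h) by rewrite lt_neqAle eq_sym p0 rnorm_ge0.
rewrite -(ler_pM2r pp) -[leLHS]ger0_norm ?mulr_ge0 ?rnorm_ge0 // -rnormr -expr2 -innerE.
by rewrite inner_oproj esP cauchy_schwarz.
Qed.

Lemma summable_tail (a : nat -> R) : (forall n, 0 <= a n) -> cvgn (series a) ->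
  forall e, 0 < e -> exists N, forall n, \sum_(N <= i < n) a i <= e.
Proof.
move=> a0 ac e e0.
have nd : nondecreasing_seq (series a) by apply: nondecreasing_series => n _ _; exact: a0.
have /cvgrPdist_lt/(_ _ e0)[N _ NP] := ac.
exists N => n; have [Nn|nN] := leqP N n; last by rewrite big_geq ?ltW // ltnW.
have := NP N (leqnn N); have := nondecreasing_cvgn_le nd ac n.
rewrite (_ : \sum_(N <= i < n) a i = series a n - series a N); last by rewrite sub_series_geq.
move=> h1 h2; have := ler_norm (limn (series a) - series a N); lra.
Qed.

(** The trace of an expansion is approximated by the compressions of the operator
    to finite-dimensional spaces, which depend on the operator alone. Applying
    the projection to the [x i] changes nothing for [i < N], and affects the
    remaining terms by at most twice the tail of the series of norms. *)
Lemma nuclear_trace_oproj A x y (e : R) : nuclear_expansion A x y -> 0 < e ->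
  exists N, forall (t : R[i]) es,
    series (fun n => inner H (x n) (y n)) @ \oo --> t ->
    (forall h, oproj es (oproj es h) = oproj es h) ->
    (forall i, (i < N)%N -> oproj es (x i) = x i) ->
    rnorm (t - \sum_(f <- es) inner H (A f) f) <= e.
Proof.
move=> [sxy Axy] e0.
have xy0 n : 0 <= rnorm (x n) * rnorm (y n) by rewrite mulr_ge0 ?rnorm_ge0.
have e20 : 0 < e / 2 by rewrite divr_gt0.
have [N NP] := summable_tail xy0 sxy e20.
exists N => t es st esP esx.
(* The compressed partial sums converge to the trace of the compression. *)
pose a n := inner H (x n) (y n); pose b n := inner H (oproj es (x n)) (y n).
have sb n : series b n = \sum_(f <- es) inner H (series (fun n => inner H f (y n) *: x n) n) f.
  rewrite /series /=; under [RHS]eq_bigr do rewrite inner_suml.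
  rewrite exchange_big /=; apply: eq_bigr => i _.
  by rewrite /b inner_suml; apply: eq_bigr => f _; rewrite !innerZl mulrC.
have cb : series b @ \oo --> \sum_(f <- es) inner H (A f) f.
  rewrite (funext sb); elim: (es) => [|f fs IH].
    by rewrite big_nil; under eq_fun do rewrite big_nil; exact: cvg_cst.
  rewrite big_cons; under eq_fun do rewrite big_cons.
  have hf : inner H (series (fun n => inner H f (y n) *: x n) n) f @[n --> \oo] -->
      inner H (A f) f.
    apply/cvg_rnormP => d d0.
    have d10 : 0 < d / (rnorm f + 1) by rewrite divr_gt0 // ltr_wpDl ?rnorm_ge0.
    have /cvg_rnormP/(_ _ d10) := Axy f; apply: filterS => n h.
    rewrite -innerBl; apply: le_lt_trans (cauchy_schwarz _ _) _.
    move: h; rewrite ltr_pdivlMr ?ltr_wpDl ?rnorm_ge0 // => h.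
    by apply: le_lt_trans h; rewrite ler_wpM2l ?rnorm_ge0 // lerDl.
  exact: (cvgD hf IH).
have ab n : rnorm (series a n - series b n) <= e.
  rewrite /series /= -sumrB.
  apply: (@le_trans _ _ (\sum_(0 <= i < n)
      if (N <= i)%N then 2 * (rnorm (x i) * rnorm (y i)) else 0)).
    elim: n => [|n IH]; first by rewrite !big_geq // rnorm0.
    rewrite !big_nat_recr //= (le_trans (ler_rnormD _ _)) // lerD //.
    rewrite /a /b; case: leqP => nN; last by rewrite esx // subrr rnorm0.
    rewrite -innerBl (le_trans (cauchy_schwarz _ _)) // mulrA ler_wpM2r ?rnorm_ge0 //.
    have := ler_rnormB (x n) (oproj es (x n)); have := rnorm_oproj (x n) esP; lra.
  apply: (@le_trans _ _ (\sum_(N <= i < n) 2 * (rnorm (x i) * rnorm (y i)))).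
    have [Nn|nN] := leqP N n; last first.
      rewrite [leRHS]big_geq 1?ltnW // big_nat_cond big1 // => i /andP[/andP[_ i_n] _].
      by rewrite leqNgt (ltn_trans i_n nN).
    rewrite (big_cat_nat (n := N)) //= big_nat_cond big1 ?add0r; last first.
      by move=> i /andP[/andP[_ iN] _]; rewrite leqNgt iN.
    by rewrite !big_nat; apply: ler_sum => i /andP[->].
  by rewrite -mulr_sumr; have := NP n; lra.
have cab : (fun n => series a n - series b n) @ \oo --> t - \sum_(f <- es) inner H (A f) f.
  exact: (cvgB st cb).
apply: (cvgr_to_le (cvg_rnorm cab)); exact: nearW.
Qed.

(** A projection that fixes long initial segments of both sequences [x] and [x']
    gives one compression close to both values. *)
Lemma nuclear_trace_uniq A x y x' y' (t t' : R[i]) :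
  nuclear_expansion A x y -> nuclear_expansion A x' y' ->
  series (fun n => inner H (x n) (y n)) @ \oo --> t ->
  series (fun n => inner H (x' n) (y' n)) @ \oo --> t' -> t = t'.
Proof.
move=> Axy Axy' st st'; apply/subr0_eq/rnorm_eq0/eqP.
rewrite eq_le rnorm_ge0 andbT; apply/ler_addgt0Pl => e e0; rewrite addr0.
have e20 : 0 < e / 2 by rewrite divr_gt0.
have [N NP] := nuclear_trace_oproj Axy e20.
have [N' NP'] := nuclear_trace_oproj Axy' e20.
have [es [esx esP]] := oproj_ex (mkseq x N ++ mkseq x' N').
have h1 := NP t es st esP; have h2 := NP' t' es st' esP.
have {}h1 : rnorm (t - \sum_(f <- es) inner H (A f) f) <= e / 2.
  by apply: h1 => i iN; apply: esx; rewrite mem_cat map_f // mem_iota.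
have {}h2 : rnorm (t' - \sum_(f <- es) inner H (A f) f) <= e / 2.
  by apply: h2 => i iN; apply: esx; rewrite mem_cat orbC map_f // mem_iota.
have := ler_rdistD (\sum_(f <- es) inner H (A f) f) t t'.
by rewrite (rdistC (\sum_(f <- es) _) t'); lra.
Qed.

Lemma traceE A x y : nuclear_expansion A x y ->
  series (fun n => inner H (x n) (y n)) @ \oo --> trace A.
Proof.
move=> Axy.
have [t st] : exists t : R[i], series (fun n => inner H (x n) (y n)) @ \oo --> t.
  apply: abs_series_cvg; apply: (series_le_cvg _ _ _ Axy.1) => n /=.
  - exact: rnorm_ge0.
  - by rewrite mulr_ge0 ?rnorm_ge0.
  - exact: cauchy_schwarz.
have tT : [set t : R[i] | exists x y, nuclear_expansion A x y /\
    series (fun n => inner H (x n) (y n)) @ \oo --> t] t by exists x, y.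
have [x' [y' [Axy' st']]] := xgetPex 0 (ex_intro _ t tT).
by rewrite /trace -(nuclear_trace_uniq Axy Axy' st st').
Qed.

End Trace.

(** * Weak-star continuous functionals *)

Section TraceMultipliers.
Variables (R : realType) (X : Type) (H : rkhs R X).
Implicit Types (f g q k : multiplier H) (A : H -> H) (x y : nat -> H).

Lemma nuclear_mulop f A x y : nuclear_expansion A x y ->
  nuclear_expansion (mulop f \o A) (mulop f \o x) y.
Proof.
move=> [sxy Axy]; split.
  have sM : cvgn (series (fun n => mnorm f * (rnorm (x n) * rnorm (y n)))).
    have -> : (fun n => mnorm f * (rnorm (x n) * rnorm (y n))) =
      mnorm f *: (fun n => rnorm (x n) * rnorm (y n)) by exact: funext.
    exact: is_cvg_seriesZ.
  apply: (series_le_cvg _ _ _ sM) => n /=.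
  - by rewrite mulr_ge0 ?rnorm_ge0.
  - by rewrite mulr_ge0 ?mnorm_ge0 // mulr_ge0 ?rnorm_ge0.
  - by rewrite mulrA ler_wpM2r ?rnorm_ge0 ?rnorm_mulop.
move=> h; apply/cvg_rnormP => e e0.
have d0 : 0 < e / (mnorm f + 1) by rewrite divr_gt0 // ltr_wpDl ?mnorm_ge0.
have /cvg_rnormP/(_ _ d0) := Axy h; apply: filterS => n hn.
have f0 : mulop f 0 = 0 by apply: mulopP; rewrite !raddf0 mulr0.
have fB u v : mulop f u - mulop f v = mulop f (u - v).
  by rewrite -[in RHS](scaleN1r v) [in RHS]addrC mulopZD scaleN1r addrC.
rewrite (_ : series _ n = mulop f (series (fun n => inner H h (y n) *: x n) n)); last first.
  rewrite /series /=; elim: n {hn} => [|n IH]; first by rewrite !big_geq.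
  by rewrite !big_nat_recr //= IH addrC -mulopZD addrC.
rewrite fB; apply: le_lt_trans (rnorm_mulop _ _) _.
move: hn; rewrite ltr_pdivlMr ?ltr_wpDl ?mnorm_ge0 // => hn.
by apply: le_lt_trans hn; rewrite mulrC ler_wpM2l ?rnorm_ge0 // lerDl.
Qed.

(** The first [N] terms carry the dependence on [g]; the tail is at most a small
    multiple of the norm of [g], uniformly in [g]. *)
Lemma trace_mulop_le A x y q (e : R) : nuclear_expansion A x y -> 0 < e ->
  exists N, forall k g, Defs.mfun k = Defs.mfun g * Defs.mfun q ->
    rnorm (trace (mulop k \o A)) <=
    \sum_(0 <= i < N) rnorm (inner H (mulop g (mulop q (x i))) (y i)) + e * mnorm g.
Proof.
move=> Axy e0.
have xy0 n : 0 <= rnorm (x n) * rnorm (y n) by rewrite mulr_ge0 ?rnorm_ge0.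
have q1 : 0 < mnorm q + 1 by rewrite ltr_wpDl ?mnorm_ge0.
have [N NP] := summable_tail xy0 Axy.1 (divr_gt0 e0 q1).
exists N => k g kE.
apply: (cvgr_to_le (cvg_rnorm (traceE (nuclear_mulop k Axy)))); apply: nearW => n.
have nsum (F : nat -> R[i]) : rnorm (series F n) <= \sum_(0 <= i < n) rnorm (F i).
  rewrite /series /=; elim: n => [|n IH]; first by rewrite !big_geq // rnorm0.
  by rewrite !big_nat_recr //= (le_trans (ler_rnormD _ _)) // lerD.
apply: le_trans (nsum _) _.
under eq_bigr do rewrite /= (mulop_mul _ kE).
have part i : rnorm (inner H (mulop g (mulop q (x i))) (y i)) <=
    mnorm g * mnorm q * (rnorm (x i) * rnorm (y i)).
  apply: le_trans (cauchy_schwarz _ _) _; rewrite mulrA ler_wpM2r ?rnorm_ge0 //.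
  apply: le_trans (rnorm_mulop _ _) _; rewrite -mulrA ler_wpM2l ?mnorm_ge0 //.
  exact: rnorm_mulop.
have tail : \sum_(N <= i < n) rnorm (inner H (mulop g (mulop q (x i))) (y i)) <= e * mnorm g.
  apply: (@le_trans _ _ (\sum_(N <= i < n) mnorm g * mnorm q * (rnorm (x i) * rnorm (y i)))).
    by apply: ler_sum => i _; exact: part.
  rewrite -mulr_sumr -mulrA [leRHS]mulrC ler_wpM2l ?mnorm_ge0 //.
  have := NP n; rewrite ler_pdivlMr // => /(le_trans _); apply.
  by rewrite mulrC ler_wpM2l ?lerDl // sumr_ge0 // => i _; exact: xy0.
have [nN|Nn] := leqP n N.
  apply: (@le_trans _ _ (\sum_(0 <= i < N) rnorm (inner H (mulop g (mulop q (x i))) (y i)))).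
    by rewrite [leRHS](big_cat_nat (n := n)) //= lerDl sumr_ge0 // => i _; exact: rnorm_ge0.
  by rewrite lerDl mulr_ge0 ?mnorm_ge0 // ltW.
by rewrite (big_cat_nat (n := N)) //= 1?ltnW // lerD.
Qed.

Lemma trace_pairingZ c f j : trace_pairing (c *: f) j = c * trace_pairing f j.
Proof.
have [x [y jxy]] := set_valP j.
have h1 := traceE (nuclear_mulop (c *: f) jxy); have h2 := traceE (nuclear_mulop f jxy).
apply: (cvg_seq_unique h1); apply/cvg_rnormP => e e0.
have d0 : 0 < e / (rnorm c + 1) by rewrite divr_gt0 // ltr_wpDl ?rnorm_ge0.
move/cvg_rnormP : h2 => /(_ _ d0); apply: filterS => n hn.
have -> : series (fun n => inner H ((mulop (c *: f) \o x) n) (y n)) n =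
    c * series (fun n => inner H ((mulop f \o x) n) (y n)) n.
  rewrite /series /= mulr_sumr; apply: eq_bigr => i _.
  rewrite -innerZl; congr (inner H _ _); apply: mulopP.
  rewrite linearZ mulopE; apply/funext => z; exact: mulrA.
rewrite -mulrBr rnormM; move: hn; rewrite ltr_pdivlMr ?ltr_wpDl ?rnorm_ge0 // => hn.
by apply: le_lt_trans hn; rewrite mulrC ler_wpM2l ?rnorm_ge0 // lerDl.
Qed.

(** A functional that is continuous for the topology defined by the functionals
    [f |-> tr (M_f A)] is dominated by finitely many of them. The topology is
    probed with the filter [F] generated by the sets where finitely many of
    these functionals are small. *)
Lemma weak_star_bound (phi : {linear multiplier H -> R[i]}) :
  weak_star_continuous phi ->
  exists (s : seq (@trace_class R X H)) (M : R), 0 <= M /\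
    forall f, rnorm (phi f) <= M * \sum_(j <- s) rnorm (trace_pairing f j).
Proof.
move=> phiC.
pose small (P : seq (@trace_class R X H) * R) : set (multiplier H) :=
  [set f | forall j, List.In j P.1 -> rnorm (trace_pairing f j) < P.2].
pose D := [set P : seq (@trace_class R X H) * R | 0 < P.2].
pose F : set_system (multiplier H) := filter_from D small.
have FF : Filter F.
  apply: filter_from_filter; first by exists ([::], 1); rewrite /D /=.
  move=> [s a] [t b] /= a0 b0; exists (s ++ t, Num.min a b).
    by rewrite /D /= lt_min; apply/andP.
  move=> f fP; split => j /= jP; have := fP j; rewrite /= lt_min => fj.
    by have /andP[] := fj (List.in_or_app _ _ _ (or_introl jP)).
  by have /andP[] := fj (List.in_or_app _ _ _ (or_intror jP)).
have tp0 j : trace_pairing (0 : multiplier H) j = 0.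
  have [x [y jxy]] := set_valP j.
  have := traceE (nuclear_mulop 0 jxy).
  rewrite (_ : series _ = cst 0); last first.
    apply/funext => n; rewrite /series /= big1 // => i _.
    by rewrite (_ : mulop 0 (x i) = 0) ?inner0l //; apply: mulopP; rewrite raddf0 mul0r.
  move=> h; apply/rnorm_eq0/eqP; rewrite eq_le rnorm_ge0 andbT.
  by apply: (cvgr_to_le (cvg_rnorm h)); apply: nearW => n; rewrite rnorm0.
have F0 : F --> (0 : initial_topology (@trace_pairing R X H)).
  have ptF : (fun f : multiplier H => trace_pairing f) @ F -->
      (trace_pairing (0 : multiplier H) : {ptws (@trace_class R X H) -> R[i]}).
    apply/cvg_sup => j A /= [_ [[B Bop <-] Bj sBA]].
    rewrite /= /proj tp0 in Bj.
    have /nbhs_ballP[[e b]] : nbhs (0 : R[i]) B by exact: open_nbhs_nbhs.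
    rewrite /= ltcE /= => /andP[/eqP -> e0] eB.
    exists ([:: j], e) => // f fj; apply: sBA; apply: eB.
    by rewrite -ball_normE /ball_ /= sub0r normrN rnormE ltcR; apply: fj; left.
  move=> A /= [_ [[B Bop <-] Bfs sBfA]].
  apply: (@filterS _ F _ _ _ sBfA).
  by apply: ptF; apply: open_nbhs_nbhs.
have : phi @ F --> phi 0 by apply: cvg_trans (phiC 0); exact: cvg_app.
rewrite linear0 => /cvg_rnormP/(_ 1 ltr01)[[s e] /= e0 sP].
rewrite /D /= in e0.
exists s, e^-1; split=> [|f]; first by rewrite invr_ge0 ltW.
set S := \sum_(j <- s) _; have S0 : 0 <= S by apply: sumr_ge0 => j _; exact: rnorm_ge0.
rewrite mulrC ler_pdivlMr //; apply/ler_addgt0Pl => t t0.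
(* Rescale f so that the functionals at hand become smaller than e. *)
have St : 0 < t + S by rewrite ltr_pwDl.
have /sP : small (s, e) ((e / (t + S))%:C *: f).
  move=> j js /=; rewrite trace_pairingZ rnormM rnormr ger0_norm; last by rewrite ltW ?divr_gt0.
  rewrite mulrAC ltr_pdivrMr // ltr_pM2l //.
  rewrite ltr_pwDl // /S; elim: (s) js => //= a r IH [->|/IH h]; rewrite big_cons.
    by rewrite lerDl sumr_ge0 // => i _; exact: rnorm_ge0.
  by rewrite (le_trans h) // lerDr rnorm_ge0.
rewrite subr0 linearZ /= rnormM rnormr ger0_norm; last by rewrite ltW ?divr_gt0.
by rewrite mulrAC ltr_pdivrMr // mul1r mulrC => /ltW.
Qed.

End TraceMultipliers.

(** * Inner product, unitary maps and polynomials on complex space *)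

Section Euclid.
Variables (R : realType) (d : nat).
Local Notation C := R[i].
Implicit Types (x y z w v : 'rV[C]_d) (c : C).

(** The squared Euclidean norm, as a real number. *)
Definition esq z : R := \sum_i rnorm (z 0 i) ^+ 2.

Lemma cdotzz z : cdot z z = (esq z)%:C.
Proof.
by rewrite /cdot /esq rmorph_sum; apply: eq_bigr => i _; rewrite mul_conj_rnorm.
Qed.

Lemma esq_ge0 z : 0 <= esq z.
Proof. by apply: sumr_ge0 => i _; exact: sqr_ge0. Qed.

Lemma unit_ballE z : (@unit_ball R d) z <-> esq z < 1.
Proof. by rewrite /unit_ball /= cdotzz -[1](rmorph1 (real_complex R)) ltcR. Qed.

Lemma closed_unit_ballE z : (@closed_unit_ball R d) z <-> esq z <= 1.
Proof. by rewrite /closed_unit_ball /= cdotzz -[1](rmorph1 (real_complex R)) lecR. Qed.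

Lemma unit_sphereE z : (@unit_sphere R d) z <-> esq z = 1.
Proof.
rewrite /unit_sphere /= cdotzz -[1](rmorph1 (real_complex R)).
by split=> [/complexI|->].
Qed.

Lemma cdotDl x y z : cdot (x + y) z = cdot x z + cdot y z.
Proof. by rewrite -big_split; apply: eq_bigr => i _; rewrite !mxE mulrDl. Qed.

Lemma cdotZl c x z : cdot (c *: x) z = c * cdot x z.
Proof. by rewrite mulr_sumr; apply: eq_bigr => i _; rewrite !mxE mulrA. Qed.

Lemma cdotC x z : cdot z x = Num.conj (cdot x z).
Proof.
rewrite /cdot raddf_sum; apply: eq_bigr => i _ /=.
by rewrite conjM conjCK mulrC.
Qed.

Lemma cdotDr x y z : cdot z (x + y) = cdot z x + cdot z y.
Proof. by rewrite cdotC cdotDl conjD -!cdotC. Qed.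

Lemma cdotZr c x z : cdot z (c *: x) = Num.conj c * cdot z x.
Proof. by rewrite cdotC cdotZl conjM -!cdotC. Qed.

Lemma cdotBl x y z : cdot (x - y) z = cdot x z - cdot y z.
Proof. by rewrite cdotDl -scaleN1r cdotZl mulN1r. Qed.

Lemma cdotBr x y z : cdot z (x - y) = cdot z x - cdot z y.
Proof. by rewrite cdotC cdotBl conjB -!cdotC. Qed.

Lemma esqZ c z : esq (c *: z) = rnorm c ^+ 2 * esq z.
Proof.
by rewrite /esq mulr_sumr; apply: eq_bigr => i _; rewrite mxE rnormM exprMn.
Qed.

Lemma esq_eq0 z : esq z = 0 -> z = 0.
Proof.
move=> /eqP; rewrite psumr_eq0 => [|i _]; last exact: sqr_ge0.
move=> /allP h; apply/rowP => i; rewrite mxE; apply: rnorm_eq0; apply/eqP.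
by rewrite -sqrf_eq0; apply: (implyP (h i _)); rewrite ?mem_index_enum.
Qed.

Lemma esqB x z : esq (x - z) = esq x + esq z - 2 * complex.Re (cdot x z).
Proof.
apply: (@complexI R); rewrite -cdotzz cdotBl !cdotBr !cdotzz (cdotC x z).
have -> : (esq x + esq z - 2 * complex.Re (cdot x z))%:C =
    (esq x)%:C + (esq z)%:C - (2 * complex.Re (cdot x z))%:C.
  by rewrite rmorphB rmorphD.
have -> : (2 * complex.Re (cdot x z))%:C = cdot x z + Num.conj (cdot x z).
  case: (cdot x z) => a b; apply/eqP; rewrite eq_complex /= addrN.
  by apply/andP; split; apply/eqP => //; ring.
by ring.
Qed.

Lemma rnorm_cdot x z : rnorm (cdot x z) ^+ 2 <= esq x * esq z.
Proof.
have [z0|z0] := eqVneq (esq z) 0.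
  by rewrite z0 (esq_eq0 z0) -(scale0r 0) cdotZr rmorph0 mul0r rnorm0 mulr0 expr0n.
have zp : 0 < esq z by rewrite lt_neqAle eq_sym z0 esq_ge0.
have := esq_ge0 (x - (cdot x z * (esq z)^-1%:C) *: z).
rewrite esqB esqZ cdotZr conjM conjr rnormM rnormr ger0_norm ?invr_ge0 ?esq_ge0 //.
rewrite (_ : complex.Re _ = rnorm (cdot x z) ^+ 2 / esq z).
  rewrite exprMn (_ : _ * _ * esq z = rnorm (cdot x z) ^+ 2 / esq z); last by field.
  by rewrite -ler_pdivrMr // => h; lra.
by rewrite mulrAC (mulrC (Num.conj _)) mul_conj_rnorm -rmorphM.
Qed.

(** The complex analogue of a Householder reflection: it is unitary as soon as
    twice the real part of [c] is the squared norm of [v], and it then maps [x]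
    to [x - v] when [c] is nonzero and equal to the inner product of [x] and
    [v]. A zero [c] yields the identity map. *)
Definition reflection (c : C) v x : 'rV[C]_d := x - (cdot x v / c) *: v.

Lemma reflection_cdot c v x y : cdot v v = c + Num.conj c ->
  cdot (reflection c v x) (reflection c v y) = cdot x y.
Proof.
move=> vc; have [->|c0] := eqVneq c 0.
  by rewrite /reflection invr0 !mulr0 !scale0r !subr0.
have cc0 : Num.conj c != 0 by rewrite conjC_eq0.
rewrite /reflection cdotBl !cdotBr cdotZl !cdotZr cdotZl vc (cdotC v y).
rewrite !conjM !conjV.
by rewrite !conjCK; field; rewrite c0 cc0.
Qed.

(** For unit vectors with [w <> - z], a unitary map sending [z] to [w]. A single
    reflection taking [z] to [w] does not tend to the identity as [w] tends to
    [z]; here the first reflection takes [z] to [- z] and the second one takes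
    [- z] to [w], so that the two cancel for [w = z]. *)
Definition move_point z w x : 'rV[C]_d :=
  reflection (1 + cdot z w) (z + w) (reflection 2%:R (z + z) x).

Lemma move_point_cdot z w x y : esq z = 1 -> esq w = 1 ->
  cdot (move_point z w x) (move_point z w y) = cdot x y.
Proof.
move=> z1 w1; have zz : cdot z z = 1 by rewrite cdotzz z1.
have ww : cdot w w = 1 by rewrite cdotzz w1.
rewrite /move_point !reflection_cdot //.
  rewrite cdotDl !cdotDr zz; rewrite (_ : Num.conj 2%:R = 2%:R); first by ring.
  by rewrite conjC_nat.
rewrite cdotDl !cdotDr zz ww (cdotC z w) conjD (_ : Num.conj 1 = 1); first by ring.
by rewrite conjC1.
Qed.

Lemma move_pointE z w : esq z = 1 -> 1 + cdot z w != 0 -> move_point z w z = w.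
Proof.
move=> z1 zw; have zz : cdot z z = 1 by rewrite cdotzz z1.
have -> : move_point z w z = reflection (1 + cdot z w) (z + w) (- z).
  rewrite /move_point; congr reflection; rewrite /reflection cdotDr zz divff ?scale1r ?pnatr_eq0 //.
  by rewrite opprD addrA subrr sub0r.
have zE : cdot (- z) (z + w) = - (1 + cdot z w).
  by rewrite -scaleN1r cdotZl cdotDr zz mulN1r.
by rewrite /reflection zE mulNr divff // scaleNr scale1r opprK addKr.
Qed.

Lemma move_point_id z x : esq z = 1 -> move_point z z x = x.
Proof.
move=> z1; have zz : cdot z z = 1 by rewrite cdotzz z1.
rewrite /move_point /reflection cdotBl cdotZl !cdotDr !cdotDl zz.
set c := cdot x z; rewrite -addrA -opprD -scalerDl.
have -> : (c + c) / 2%:R + (c + c - (c + c) / 2%:R * (1 + 1 + (1 + 1))) / (1 + 1) = 0 :> C.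
  by field.
by rewrite scale0r subr0.
Qed.

Definition polynomial_fun (f : 'rV[C]_d -> C) : Prop := exists p, f = peval p.

Lemma polynomial_fun_cst c : polynomial_fun (fun=> c).
Proof. by exists (mpoly.mpolyC d c); apply/funext => x; rewrite /peval mpoly.mevalC. Qed.

Lemma polynomial_fun_coord i : polynomial_fun (fun x => x 0 i).
Proof.
by exists (mpoly.mpolyX C (mpoly.mnm1 i)); apply/funext => x; rewrite /peval mpoly.mevalXU.
Qed.

Lemma polynomial_funD f g : polynomial_fun f -> polynomial_fun g ->
  polynomial_fun (fun x => f x + g x).
Proof.
move=> [p ->] [q ->]; exists ((p : mpoly.mpoly d C) + q).
by apply/funext => x; rewrite /peval mpoly.mevalD.
Qed.

Lemma polynomial_funM f g : polynomial_fun f -> polynomial_fun g ->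
  polynomial_fun (fun x => f x * g x).
Proof.
move=> [p ->] [q ->]; exists ((p : mpoly.mpoly d C) * q).
by apply/funext => x; rewrite /peval mpoly.mevalM.
Qed.
End Euclid.

(** * Continuity of polynomials and of power series *)

Section BigLimits.
Context (K : numFieldType) (T : Type) (F : set_system T) {FF : Filter F}.

Lemma cvg_seq_sum (I : Type) (s : seq I) (f : I -> T -> K) (a : I -> K) :
  (forall i, f i @ F --> a i) -> (fun t => \sum_(i <- s) f i t) @ F --> \sum_(i <- s) a i.
Proof.
move=> fa; elim: s => [|i s IH].
  rewrite big_nil (_ : (fun t => _) = cst 0); first exact: cvg_cst.
  by apply/funext => t; rewrite big_nil.
rewrite big_cons (_ : (fun t => _) = (fun t => f i t + \sum_(j <- s) f j t)).
  exact: (cvgD (fa i) IH).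
by apply/funext => t; rewrite big_cons.
Qed.

Lemma cvg_seq_prod (I : Type) (s : seq I) (f : I -> T -> K) (a : I -> K) :
  (forall i, f i @ F --> a i) -> (fun t => \prod_(i <- s) f i t) @ F --> \prod_(i <- s) a i.
Proof.
move=> fa; elim: s => [|i s IH].
  rewrite big_nil (_ : (fun t => _) = cst 1); first exact: cvg_cst.
  by apply/funext => t; rewrite big_nil.
rewrite big_cons (_ : (fun t => _) = (fun t => f i t * \prod_(j <- s) f j t)).
  exact: (cvgM (fa i) IH).
by apply/funext => t; rewrite big_cons.
Qed.

Lemma cvg_pow (f : T -> K) (a : K) n : f @ F --> a -> (fun t => f t ^+ n) @ F --> a ^+ n.
Proof.
move=> fa; elim: n => [|n IH].
  rewrite expr0 (_ : (fun t => _) = cst 1); first exact: cvg_cst.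
  by apply/funext => t; rewrite expr0.
rewrite exprS (_ : (fun t => _) = (fun t => f t * f t ^+ n)).
  exact: (cvgM fa IH).
by apply/funext => t; rewrite exprS.
Qed.
End BigLimits.

Section PolynomialFunctions.
Variables (R : realType) (d : nat).
Local Notation C := R[i].
Implicit Types (x y z w v : 'rV[C]_d) (c : C).

Lemma polynomial_fun_sum (I : Type) (s : seq I) (f : I -> 'rV[C]_d -> C) :
  (forall i, polynomial_fun (f i)) -> polynomial_fun (fun x => \sum_(i <- s) f i x).
Proof.
move=> fP; elim: s => [|i s IH].
  under eq_fun do rewrite big_nil; exact: polynomial_fun_cst.
by under eq_fun do rewrite big_cons; exact: polynomial_funD.
Qed.

Lemma polynomial_funX f n : polynomial_fun f -> polynomial_fun (fun x : 'rV[C]_d => f x ^+ n).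
Proof.
move=> fP; elim: n => [|n IH].
  under eq_fun do rewrite expr0; exact: polynomial_fun_cst.
by under eq_fun do rewrite exprS; exact: polynomial_funM.
Qed.

Lemma polynomial_fun_cdot v : polynomial_fun (fun x => cdot x v).
Proof.
apply: polynomial_fun_sum => i.
by apply: polynomial_funM; [exact: polynomial_fun_coord|exact: polynomial_fun_cst].
Qed.

Lemma polynomial_fun_comp f (T : 'rV[C]_d -> 'rV[C]_d) : polynomial_fun f ->
  (forall i, polynomial_fun (fun x => T x 0 i)) -> polynomial_fun (f \o T).
Proof.
move=> [p ->] /choice[q qP]; exists (mpoly.comp_mpoly [tuple q i | i < d] p).
apply/funext => x; rewrite /peval mpoly.comp_mpoly_meval /=.
by apply: mpoly.meval_eq => i; rewrite tnth_mktuple; exact: (congr1 (@^~ x) (qP i)).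
Qed.

Lemma polynomial_fun_reflection c v i : polynomial_fun (fun x => reflection c v x 0 i).
Proof.
under eq_fun do rewrite /reflection !mxE -mulrN.
apply: polynomial_funD; first exact: polynomial_fun_coord.
apply: polynomial_funM; last exact: polynomial_fun_cst.
by apply: polynomial_funM; [exact: polynomial_fun_cdot|exact: polynomial_fun_cst].
Qed.

Lemma polynomial_fun_move_point z w i : polynomial_fun (fun x => move_point z w x 0 i).
Proof.
exact: (polynomial_fun_comp (polynomial_fun_reflection _ _ i) (polynomial_fun_reflection _ _)).
Qed.

Lemma polynomial_fun_continuous f : polynomial_fun f -> continuous (f : 'rV[C]_d -> C).
Proof.
move=> [p ->] x; rewrite /continuous_at.
have E y : peval p y = \sum_(m <- mpoly.msupp p) mpoly.mcoeff m p *
    \prod_(i <- index_enum 'I_d) y 0 i ^+ mpoly.fun_of_multinom m i.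
  exact: mpoly.mevalE.
rewrite (funext E); apply: (@cvg_seq_sum _ _ (nbhs x)) => m.
apply: (@cvgM _ _ (nbhs x) _ _ _ _ _ (cvg_cst _)); apply: (@cvg_seq_prod _ _ (nbhs x)) => i.
have h := @coord_continuous C 1 d 0 i x.
have := @cvg_pow _ _ (nbhs x) _ _ _ (mpoly.fun_of_multinom m i) h.
by apply; exact: nbhs_filter.
Qed.

Lemma closed_ball_near w (V : set 'rV[C]_d) : esq w <= 1 -> nbhs w V ->
  exists2 x, esq x < 1 & V x.
Proof.
move=> w1 wV.
have sw : (fun n : nat => (1 - n.+1%:R^-1)%:C *: w) @ \oo --> w.
  rewrite -[w in X in _ --> X]scale1r; apply: cvgZr_tmp.
  apply/cvg_rnormP => e e0.
  have [N _ NP] := near_infty_natSinv_lt (PosNum e0).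
  exists N => // n /NP /=.
  rewrite rmorphB rmorph1 addrAC subrr sub0r rnormN rnormr ger0_norm //.
have [N _ /(_ N (leqnn N)) NV] := sw _ wV.
exists ((1 - N.+1%:R^-1)%:C *: w) => //.
rewrite esqZ rnormr real_normK ?num_real //.
have h1 : (N.+1%:R : R)^-1 <= 1 by rewrite invf_le1 // ler1n.
have h0 : 0 < (N.+1%:R : R)^-1 by rewrite invr_gt0.
move: h0 h1; move: (N.+1%:R^-1) => t t0 t1.
apply: (@le_lt_trans _ _ ((1 - t) ^+ 2 * 1)); first by rewrite ler_wpM2l ?sqr_ge0.
by rewrite mulr1; nra.
Qed.

(** The open ball is dense in the closed one. *)
Lemma closed_ball_bound (G : 'rV[C]_d -> C) (M : R) :
  {within @closed_unit_ball R d, continuous G} ->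
  (forall x, esq x < 1 -> rnorm (G x) <= M) ->
  forall w, esq w <= 1 -> rnorm (G w) <= M.
Proof.
move=> Gc GM w w1; apply/ler_addgt0Pl => e e0.
have wB : (@closed_unit_ball R d) w by apply/closed_unit_ballE.
have /subspace_continuousP/(_ w wB)/cvg_rnormP/(_ _ e0) := Gc.
rewrite near_withinE => /(closed_ball_near w1)[x x1 xB].
have {}xB : rnorm (G x - G w) < e by apply: xB; apply/closed_unit_ballE/ltW.
have := ler_rdistD (G x) (G w) 0; rewrite !subr0 (rdistC (G w)).
have := GM x x1; lra.
Qed.
End PolynomialFunctions.

Section PowerSeries.
Variable R : realType.

Lemma pow_sub_bound (t s : R[i]) (r : R) n : rnorm t <= r -> rnorm s <= r ->
  rnorm (t ^+ n - s ^+ n) <= n%:R * (r + 1) ^+ n * rnorm (t - s).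
Proof.
move=> tr sr; have r0 : 0 <= r by apply: le_trans tr; exact: rnorm_ge0.
elim: n => [|n IH]; first by rewrite !expr0 subrr rnorm0 !mul0r.
have -> : t ^+ n.+1 - s ^+ n.+1 = t * (t ^+ n - s ^+ n) + (t - s) * s ^+ n.
  by rewrite !exprS; ring.
apply: le_trans (ler_rnormD _ _) _; rewrite !rnormM rnormX.
have sn : rnorm s ^+ n <= (r + 1) ^+ n.+1.
  apply: (@le_trans _ _ ((r + 1) ^+ n)).
    by rewrite lerXn2r ?nnegrE ?rnorm_ge0 ?addr_ge0 // (le_trans sr) // lerDl.
  by rewrite exprS ler_peMl ?exprn_ge0 ?addr_ge0 // lerDr.
have h1 : rnorm t * rnorm (t ^+ n - s ^+ n) <= (r + 1) * (n%:R * (r + 1) ^+ n * rnorm (t - s)).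
  by rewrite ler_pM ?rnorm_ge0 // (le_trans tr) // lerDl.
have h2 : rnorm (t - s) * rnorm s ^+ n <= rnorm (t - s) * (r + 1) ^+ n.+1.
  by rewrite ler_wpM2l ?rnorm_ge0.
apply: le_trans (lerD h1 h2) _; rewrite -natr1 le_eqVlt; apply/orP; left; apply/eqP.
by rewrite exprS; ring.
Qed.

(** On the disc of radius [r] the terms of the series are dominated by the
    convergent series of the [a n * r ^+ n]; after cutting off the tail there
    remains a polynomial, handled by [pow_sub_bound]. *)
Lemma power_series_continuous_at (a : nat -> R) (r : R) (G0 : R[i]) (e : R) :
  (forall n, 0 <= a n) -> 0 <= r ->
  series (fun n => (a n)%:C * (r%:C) ^+ n) @ \oo --> G0 -> 0 < e ->
  exists2 b : R, 0 < b & forall (t G : R[i]), rnorm t <= r -> rnorm (t - r%:C) < b ->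
    series (fun n => (a n)%:C * t ^+ n) @ \oo --> G -> rnorm (G - G0) < e.
Proof.
move=> a0 r0 sG0 e0.
have an0 n : 0 <= a n * r ^+ n by rewrite mulr_ge0 ?exprn_ge0.
have sR n : series (fun n => (a n)%:C * (r%:C) ^+ n) n = (series (fun n => a n * r ^+ n) n)%:C.
  rewrite /series /= rmorph_sum; apply: eq_bigr => i _.
  by rewrite rmorphM /= -rmorphXn.
have sc : cvgn (series (fun n => a n * r ^+ n)).
  apply/cvg_ex; exists (complex.Re G0); apply/cvgrPdist_lt => t t0.
  move/cvg_rnormP : sG0 => /(_ _ t0); apply: filterS => n; rewrite sR distrC.
  apply: le_lt_trans; apply: le_trans (ler_Re_rnorm _); case: (G0) => x y //=.
have e80 : 0 < e / 8 by rewrite divr_gt0.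
have [N NP] := summable_tail an0 sc e80.
pose K := \sum_(0 <= i < N) a i * (i%:R * (r + 1) ^+ i).
have K0 : 0 <= K.
  by apply: sumr_ge0 => i _; rewrite !mulr_ge0 // exprn_ge0 // addr_ge0.
exists (e / 4 / (K + 1)) => [|t G tr tb sG]; first by rewrite !divr_gt0 // ltr_wpDl.
have rr : rnorm (r%:C : R[i]) <= r by rewrite rnormr ger0_norm.
have Kb : K * rnorm (t - r%:C) <= e / 4.
  move: tb; rewrite ltr_pdivlMr ?ltr_wpDl // => tb.
  by apply: le_trans (ltW tb); rewrite mulrC ler_wpM2l ?rnorm_ge0 // lerDl.
have bound n : rnorm (series (fun n => (a n)%:C * t ^+ n) n -
    series (fun n => (a n)%:C * (r%:C) ^+ n) n) <= e / 2.
  rewrite /series /= -sumrB.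
  apply: (@le_trans _ _ (\sum_(0 <= i < n)
        (if (i < N)%N then a i * (i%:R * (r + 1) ^+ i) * rnorm (t - r%:C) else 0)
      + \sum_(0 <= i < n) (if (N <= i)%N then 2 * (a i * r ^+ i) else 0))).
    rewrite -big_split /=; elim: n => [|n IH]; first by rewrite !big_geq // rnorm0.
    rewrite !big_nat_recr //= (le_trans (ler_rnormD _ _)) // lerD //.
    rewrite -mulrBr rnormM rnormr ger0_norm //; case: ltnP => _.
      by rewrite addr0 -mulrA ler_wpM2l // pow_sub_bound.
    rewrite add0r mulrCA ler_wpM2l // (le_trans (ler_rnormB _ _)) // !rnormX.
    have : rnorm t ^+ n <= r ^+ n by rewrite lerXn2r ?nnegrE ?rnorm_ge0.
    have : rnorm (r%:C : R[i]) ^+ n <= r ^+ n by rewrite lerXn2r ?nnegrE ?rnorm_ge0.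
    lra.
  have -> : e / 2 = e / 4 + 2 * (e / 8) by field.
  apply: lerD.
    apply: le_trans Kb; rewrite /K mulr_suml -big_mkcond /=.
    have [nN|Nn] := leqP n N.
      rewrite [leRHS](big_cat_nat (n := n)) //=; rewrite -[leLHS]addr0 lerD //.
        rewrite big_mkcond /=; apply: ler_sum => i _; case: ifP => // _.
        by rewrite !mulr_ge0 ?rnorm_ge0 // exprn_ge0 // addr_ge0.
      by apply: sumr_ge0 => i _; rewrite !mulr_ge0 ?rnorm_ge0 // exprn_ge0 // addr_ge0.
    rewrite (big_cat_nat (n := N)) //= 1?ltnW // [X in _ + X]big_nat_cond.
    rewrite [X in _ + X]big1 ?addr0; last first.
      by move=> i /andP[/andP[Ni _]]; rewrite ltnNge Ni.
    rewrite big_mkcond /=; apply: ler_sum => i _; case: ifP => // _.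
    by rewrite !mulr_ge0 ?rnorm_ge0 // exprn_ge0 // addr_ge0.
  rewrite -big_mkcond /= -mulr_sumr ler_pM2l //.
  apply: le_trans (NP n).
  have [Nn|nN] := leqP N n; last first.
    rewrite [leRHS]big_geq 1?ltnW // big_nat_cond big1 // => i /andP[/andP[_ i_n]].
    by rewrite leqNgt (ltn_trans i_n nN).
  rewrite (big_cat_nat (n := N)) //= [X in X + _]big_nat_cond [X in X + _]big1 ?add0r; last first.
    by move=> i /andP[/andP[_ iN]]; rewrite leqNgt iN.
  by rewrite big_mkcond /=; apply: ler_sum => i _; case: ifP.
apply: (@le_lt_trans _ _ (e / 2)); last by lra.
exact: (cvgr_to_le (cvg_rnorm (cvgB sG sG0)) (nearW _ bound)).
Qed.
End PowerSeries.

(** * Symmetries and continuity of the kernel *)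

Section KernelSymmetry.
Variables (R : realType) (X : Type) (H : rkhs R X).

Lemma inner_kvec (x y : X) : inner H (kvec H x) (kvec H y) = Defs.kernel H y x.
Proof. by rewrite -reproducing. Qed.

(** A map [T] that preserves the kernel preserves the Gram matrices of kernel
    vectors, through which the multiplier norm is computed. *)
Lemma mnorm_comp (T : X -> X) (f g : multiplier H) :
  (forall x y, Defs.kernel H (T x) (T y) = Defs.kernel H x y) ->
  (forall x, g x = f (T x)) -> mnorm g <= mnorm f.
Proof.
move=> TK gE; pose tT (s : seq (R[i] * X)) := [seq (p.1, T p.2) | p <- s].
have nT s : rnorm (kcomb H (tT s)) = rnorm (kcomb H s).
  apply/eqP; rewrite -(@eqrXn2 _ 2) ?rnorm_ge0 //; apply/eqP/(@complexI R).
  rewrite -!innerE /kcomb big_map !inner_suml; apply: eq_bigr => p _.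
  rewrite !inner_sumr; apply: eq_bigr => q _.
  by rewrite !innerZl !innerZr !inner_kvec TK.
apply: mnorm_le_adj_comb => [|s]; first exact: mnorm_ge0.
rewrite -[in leRHS]nT -nT (_ : tT (adj_comb g s) = adj_comb f (tT s)); last first.
  by rewrite /tT /adj_comb -!map_comp; apply: eq_map => p /=; rewrite gE.
exact: rnorm_adj_comb.
Qed.
End KernelSymmetry.

Section RegularSpace.
Variables (R : realType) (d : nat) (H : rkhs R (@unit_ball R d)).
Hypothesis hH : regular_unitarily_invariant H.
Local Notation C := R[i].
Local Notation ball_type := (set_type (@unit_ball R d)).
Implicit Types (x y u v : ball_type) (z w : 'rV[C]_d) (f g : multiplier H).

Lemma set_val_ball x : esq (set_val x) < 1.
Proof. by apply/unit_ballE; exact: set_valP. Qed.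

Lemma ball_point z : esq z < 1 -> exists x, set_val x = z.
Proof.
by move=> /unit_ballE zB; exists (exist _ z (mem_set zB)).
Qed.

Lemma kernel_cdot x y u v : cdot (set_val x) (set_val y) = cdot (set_val u) (set_val v) ->
  Defs.kernel H x y = Defs.kernel H u v.
Proof.
move: hH => [a [_ _ _ aK]] E.
by have h := aK x y; rewrite E in h; exact: (cvg_seq_unique h (aK u v)).
Qed.

(** The kernel vector at the origin is the constant [a 0 = 1]. *)
Lemma constant_one : exists2 e : H, fval H e = 1 & rnorm e = 1.
Proof.
move: hH => [a [a0 _ _ aK]].
have [|o oE] := @ball_point 0; first by rewrite /esq big1 // => i _; rewrite mxE rnorm0 expr0n.
have K1 x : Defs.kernel H x o = 1.
  apply: (cvg_seq_unique (aK x o)); rewrite oE.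
  have -> : cdot (set_val x) 0 = 0 by rewrite -(scale0r 0) cdotZr rmorph0 mul0r.
  apply/cvg_rnormP => e e0; exists 1%N => // n /= n0.
  rewrite /series /= big_ltn // big_nat_cond big1 ?addr0 => [|i /andP[/andP[i0 _] _]].
    by rewrite expr0 a0 mulr1 subrr rnorm0.
  by rewrite expr0n gtn_eqF // mulr0.
exists (kvec H o); first by apply/funext => x; exact: K1.
have := innerE (kvec H o); rewrite inner_kvec K1 -[1](rmorph1 (real_complex R)).
move=> /complexI/esym/eqP.
by rewrite sqrp_eq1 ?rnorm_ge0 // => /eqP.
Qed.

Lemma rnorm_mult f x : rnorm (f x) <= mnorm f.
Proof. by have [e e1 _] := constant_one; exact: rnorm_multiplier e1 f x. Qed.

Lemma rnorm_multB f x y : rnorm (f x - f y) <= mnorm f * rnorm (kvec H x - kvec H y).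
Proof.
have [e eE e1] := constant_one.
by have := rnorm_multiplierB eE f x y; rewrite e1 mulr1.
Qed.

(** The squared distance of two kernel vectors is a combination of values of the
    kernel, a power series in the inner product of the points. *)
Lemma kvec_close v (e : R) : 0 < e -> exists2 b : R, 0 < b &
  forall u, esq (set_val u) = esq (set_val v) ->
    rnorm (cdot (set_val u) (set_val v) - cdot (set_val v) (set_val v)) < b ->
    rnorm (kvec H u - kvec H v) < e.
Proof.
move: hH => [a [_ apos _ aK]] e0.
have e20 : 0 < e ^+ 2 / 2 by rewrite divr_gt0 // exprn_gt0.
have := aK v v; rewrite cdotzz => aKv.
have [b b0 bP] := power_series_continuous_at (fun n => ltW (apos n)) (esq_ge0 (set_val v)) aKv e20.
exists b => // u uv ub.
have uv2 : rnorm (cdot (set_val u) (set_val v)) <= esq (set_val v).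
  rewrite -ler_sqr ?nnegrE ?rnorm_ge0 ?esq_ge0 //.
  by rewrite (le_trans (rnorm_cdot _ _)) // uv.
have := bP _ _ uv2 ub (aK u v).
have Kuu : Defs.kernel H u u = Defs.kernel H v v by apply: kernel_cdot; rewrite !cdotzz uv.
have -> : Defs.kernel H u v = inner H (kvec H v) (kvec H u) by rewrite inner_kvec.
move=> h; rewrite -ltr_sqr ?nnegrE ?rnorm_ge0 ?ltW //.
have E : (rnorm (kvec H u - kvec H v) ^+ 2)%:C = (Defs.kernel H v v - inner H (kvec H v) (kvec H u))
    + (Defs.kernel H v v - Num.conj (inner H (kvec H v) (kvec H u))).
  rewrite -innerE innerBl !innerBr (innerC (kvec H v) (kvec H u)) !inner_kvec Kuu; ring.
have := ler_rnormD (Defs.kernel H v v - inner H (kvec H v) (kvec H u))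
  (Defs.kernel H v v - Num.conj (inner H (kvec H v) (kvec H u))).
rewrite -E rnormr ger0_norm ?sqr_ge0 //.
have Kr : Num.conj (Defs.kernel H v v) = Defs.kernel H v v by rewrite -inner_kvec innerE conjr.
rewrite -{2}Kr -conjB rnorm_conj (rdistC (Defs.kernel H v v)); lra.
Qed.

End RegularSpace.

(** * Multipliers under unitary changes of variable *)

Section MovePointNear.
Variables (R : realType) (d : nat).
Local Notation C := R[i].
Implicit Types (x y z w v : 'rV[C]_d).

Lemma cvg_conj (T : Type) (F : set_system T) {FF : Filter F} (f : T -> C) (a : C) :
  f @ F --> a -> (fun t => Num.conj (f t)) @ F --> Num.conj a.
Proof.
move=> /cvg_rnormP fa; apply/cvg_rnormP => e /fa; apply: filterS => t.
by rewrite -conjB rnorm_conj.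
Qed.

Lemma move_point_near z v (e : R) : esq z = 1 -> 0 < e ->
  \forall w \near z, rnorm (cdot (move_point z w v) v - cdot v v) < e.
Proof.
move=> z1 e0.
pose y := reflection 2%:R (z + z) v.
have E w : cdot (move_point z w v) v =
    cdot y v - Num.conj (cdot (z + w) y) / (1 + Num.conj (cdot w z)) * cdot (z + w) v.
  by rewrite {1}/move_point {1}/reflection cdotBl cdotZl -(cdotC _ y) -(cdotC _ z).
have cw u : (fun w => cdot w u) @ z --> cdot z u.
  exact: (polynomial_fun_continuous (polynomial_fun_cdot u)).
have czw u : (fun w => cdot (z + w) u) @ z --> cdot (z + z) u.
  rewrite cdotDl (_ : (fun w => _) = (fun w => cdot z u + cdot w u)).
    exact: (cvgD (cvg_cst _) (cw u)).
  by apply/funext => w; rewrite cdotDl.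
have zz : 1 + Num.conj (cdot z z) != 0.
  by rewrite cdotzz z1 conjr (rmorph1 (real_complex R)) -(natrD _ 1 1) pnatr_eq0.
have : (fun w => cdot (move_point z w v) v) @ z --> cdot (move_point z z v) v.
  rewrite (funext E) E.
  apply: (@cvgB _ _ _ (nbhs z) _ _ _ _ _ (cvg_cst _)).
  apply: (@cvgM _ _ (nbhs z) _ _ _ _ _ _ (czw v)).
  apply: (@cvgM _ _ (nbhs z) _ _ _ _ _ (cvg_conj (czw y))).
  apply: (@cvgV _ _ (nbhs z) _ _ _ zz).
  exact: (@cvgD _ _ _ (nbhs z) _ _ _ _ _ (cvg_cst _) (cvg_conj (cw z))).
by rewrite move_point_id // => /cvg_rnormP/(_ _ e0).
Qed.

Lemma move_point_defined z : esq z = 1 -> \forall w \near z, 1 + cdot z w != 0.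
Proof.
move=> z1.
have : (fun w => cdot w z) @ z --> cdot z z.
  exact: (polynomial_fun_continuous (polynomial_fun_cdot z)).
move=> /cvg_rnormP/(_ 1 ltr01); apply: filterS => w.
rewrite cdotzz z1 => h; apply/eqP => zw; move: h.
have -> : cdot w z = - 1.
  by rewrite cdotC; have -> : cdot z w = - 1; [exact/esym/addr0_eq|exact: (rmorphN1 Num.conj)].
rewrite (_ : - 1 - 1%:C = (- 2)%:C); last first.
  by rewrite (rmorph1 (real_complex R)) rmorphN rmorph_nat; ring.
by rewrite rnormr normrN ger0_norm // ltNge ler1n.
Qed.

End MovePointNear.

Section MoveMultipliers.
Variables (R : realType) (d : nat) (H : rkhs R (@unit_ball R d)).
Hypothesis hH : regular_unitarily_invariant H.
Local Notation C := R[i].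
Local Notation ball_type := (set_type (@unit_ball R d)).
Implicit Types (z w : 'rV[C]_d) (f g : multiplier H) (T : ball_type -> ball_type).

Definition moves_ball z w T := forall x, set_val (T x) = move_point z w (set_val x).

Lemma moves_ball_ex z w : esq z = 1 -> esq w = 1 -> exists T, moves_ball z w T.
Proof.
move=> z1 w1; suff /choice[T TP] : forall x : ball_type, exists y : ball_type,
  set_val y = move_point z w (set_val x) by exists T.
move=> x.
apply: ball_point; have := set_val_ball x.
suff -> : esq (move_point z w (set_val x)) = esq (set_val x) by [].
by apply: (@complexI R); rewrite -!cdotzz move_point_cdot.
Qed.

Lemma mnorm_moves z w T f g : esq z = 1 -> esq w = 1 -> moves_ball z w T ->
  (forall x, g x = f (T x)) -> mnorm g <= mnorm f.
Proof.
move=> z1 w1 Tzw; apply: mnorm_comp => x y; apply: (kernel_cdot hH).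
by rewrite !Tzw move_point_cdot.
Qed.

(** The contribution of a combination [kcomb s] in [inner_mulop_moves]: the
    distances between [kvec (T v)] and [kvec v] are weighted by the coefficients
    of [s] and the values of [h]. *)
Lemma moves_near z (h : H) s (e : R) : esq z = 1 -> 0 < e ->
  \forall w \near z, esq w = 1 -> forall T, moves_ball z w T ->
    \sum_(p <- s) rnorm (p.1 : C) * rnorm (fval H h p.2) *
      rnorm (kvec H (T p.2) - kvec H p.2) <= e.
Proof.
move=> z1; elim: s e => [|p s IH] e e0.
  by apply: (@filterE _ (nbhs z)) => w _ T _; rewrite big_nil ltW.
have e20 : 0 < e / 2 by rewrite divr_gt0.
set c := rnorm (p.1 : C) * rnorm (fval H h p.2).
have c0 : 0 <= c by rewrite mulr_ge0 ?rnorm_ge0.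
have d0 : 0 < e / 2 / (c + 1) by rewrite divr_gt0 // ltr_wpDl.
have [b b0 bP] := kvec_close hH p.2 d0.
apply: (@filterS2 _ (nbhs z) _ _ _ _ _ (IH _ e20) (move_point_near (set_val p.2) z1 b0)).
move=> w IHw wb w1 T Tzw.
have h1 : rnorm (kvec H (T p.2) - kvec H p.2) < e / 2 / (c + 1).
  apply: bP; rewrite Tzw //.
  by apply: (@complexI R); rewrite -!cdotzz move_point_cdot.
rewrite big_cons [e]splitr lerD ?IHw // -/c.
move: h1; rewrite ltr_pdivlMr ?ltr_wpDl // => h1; apply: le_trans (ltW h1).
by rewrite mulrC ler_wpM2l ?rnorm_ge0 // lerDl.
Qed.

(** The continuity, with respect to the multiplier norm and under unitary changes
    of variable, of the functional [f |-> <f h, k>]. For [k] a kernel vector at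
    [v], the difference is [h v] times [f (T v) - f v], small against the norm
    of [f] because [kvec (T v)] is close to [kvec v]. A general [k] is
    approximated by combinations of kernel vectors, at a cost controlled by
    the norm of [f \o T], which is at most that of [f]. *)
Lemma inner_mulop_moves z (h k : H) (e : R) : esq z = 1 -> 0 < e ->
  \forall w \near z, esq w = 1 -> forall T f g, moves_ball z w T ->
    (forall x, g x = f (T x)) ->
    rnorm (inner H (mulop (g - f) h) k) <= e * mnorm f.
Proof.
move=> z1 e0.
have e20 : 0 < e / 2 by rewrite divr_gt0.
have h1 : 0 < 2 * rnorm h + 1 by rewrite ltr_wpDl // mulr_ge0 ?rnorm_ge0.
have [s ks] := kcomb_dense k (divr_gt0 e20 h1).
apply: (@filterS _ (nbhs z) _ _ _ _ (moves_near h s z1 e20)) => w sw w1 T f g Tzw gE.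
have {}sw := sw w1 T Tzw.
have gf : mnorm g <= mnorm f by exact: (mnorm_moves z1 w1 Tzw gE).
have nf := mnorm_ge0 f.
have gf2 : mnorm (g - f) <= 2 * mnorm f by have := mnormB g f; lra.
rewrite -[k](subrK (kcomb H s)) innerDr; apply: le_trans (ler_rnormD _ _) _.
rewrite [e]splitr mulrDl; apply: lerD.
  apply: le_trans (cauchy_schwarz _ _) _.
  apply: (@le_trans _ _ (2 * mnorm f * rnorm h * (e / 2 / (2 * rnorm h + 1)))).
    apply: ler_pM; rewrite ?rnorm_ge0 ?(ltW ks) //.
    by apply: le_trans (rnorm_mulop _ _) _; rewrite ler_wpM2r ?rnorm_ge0.
  rewrite (_ : 2 * mnorm f * _ * _ =
    mnorm f * (2 * rnorm h * (e / 2 / (2 * rnorm h + 1)))); last by ring.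
  rewrite [leRHS]mulrC ler_wpM2l // mulrA ler_pdivrMr // mulrC ler_wpM2l ?lerDl //.
  exact: ltW.
rewrite inner_kcomb; apply: (@le_trans _ _ (\sum_(p <- s) mnorm f *
  (rnorm (p.1 : C) * rnorm (fval H h p.2) * rnorm (kvec H (T p.2) - kvec H p.2)))).
  elim: (s) => [|p r IH]; first by rewrite !big_nil rnorm0.
  rewrite !big_cons (le_trans (ler_rnormD _ _)) // lerD //.
  rewrite !rnormM rnorm_conj mulopxE rnormM.
  have -> : (g - f) p.2 = f (T p.2) - f p.2 by rewrite -gE.
  have := rnorm_multB hH f (T p.2) p.2; set A := rnorm (f _ - _); set B := rnorm (kvec _ _ - _).
  move=> AB; rewrite mulrCA.
  rewrite [leRHS](_ : _ = mnorm f * B * (rnorm p.1 * rnorm (fval H h p.2))); last by ring.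
  by rewrite ler_wpM2r // mulr_ge0 ?rnorm_ge0.
by rewrite -mulr_sumr mulrC ler_wpM2r.
Qed.

End MoveMultipliers.

(** * Integrals concentrating at a point *)

Section PeakIntegral.
Context (disp : measure_display) (T : measurableType disp) (R : realType).
Variables (m : {finite_measure set T -> \bar R}) (D : set T) (z : T).
Hypotheses (mD : measurable D) (mz : measurable [set z]) (Dz : D z).

Lemma bounded_integrable (A : set T) (u : T -> R) (M : R) : measurable A ->
  measurable_fun A u -> (forall x, A x -> `|u x| <= M) -> m.-integrable A (EFin \o u).
Proof.
move=> mA mu uM.
have mM : m.-integrable A (EFin \o cst M) by exact: finite_measure_integrable_cst.
apply: (le_integrable mA _ _ mM); first exact/measurable_EFinP.
by move=> x Ax /=; rewrite lee_fin (le_trans (uM x Ax)) // ler_norm.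
Qed.

(** Dominated convergence makes the integral of [rho ^+ n] off the point [z] tend
    to [0]. The threshold for [n] does not depend on [U] and [u], which is what
    gives estimates in norm later on. *)
Lemma peak_integral (rho : T -> R) (e : R) : measurable_fun D rho ->
  (forall x, D x -> 0 <= rho x <= 1) -> (forall x, D x -> x <> z -> rho x < 1) -> 0 < e ->
  \forall n \near \oo, forall (U : R) (u : T -> R), 0 <= U -> measurable_fun D u ->
    (forall x, D x -> `|u x| <= U * rho x ^+ n) ->
    `|Rintegral m D u - u z * fine (m [set z])| <= U * e.
Proof.
move=> mrho rho01 rho1 e0; pose D' := D `\` [set z].
have mD' : measurable D' by exact: measurableD.
have D'D : D' `<=` D by move=> x [].
have mr n : measurable_fun D' (fun x => rho x ^+ n).
  by apply: measurable_funX; exact: measurable_funS D'D mrho.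
have rn1 n x : D x -> `|rho x ^+ n| <= 1.
  by move=> /rho01/andP[r0 r1]; rewrite ger0_norm ?exprn_ge0 // exprn_ile1.
have ir n : m.-integrable D' (EFin \o (fun x => rho x ^+ n)).
  by apply: (bounded_integrable (M := 1)) => // x /D'D; exact: rn1.
have I0 : (\int[m]_(x in D') (rho x ^+ n)%:E)%E @[n --> \oo] --> 0%E.
  have [] := @dominated_convergence _ T R m D' mD' (fun n x => (rho x ^+ n)%:E) (cst 0%E) (cst 1%E).
  - by move=> n; exact/measurable_EFinP.
  - exact: measurable_cst.
  - apply: aeW => x [Dx xz]; apply: cvg_EFin; first exact: nearW.
    apply: cvg_expr; have /andP[r0 _] := rho01 _ Dx.
    by rewrite ger0_norm // rho1.
  - exact: finite_measure_integrable_cst.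
  - by apply: aeW => x n /D'D Dx; rewrite lee_fin; exact: rn1.
  by move=> _ _; rewrite integral0.
have /cvgrPdist_lt/(_ _ e0) : Rintegral m D' (fun x => rho x ^+ n) @[n --> \oo] --> (0 : R).
  exact: (fine_cvg I0).
apply: filterS => n In U u U0 mu uU.
have iu : m.-integrable D (EFin \o u).
  apply: (bounded_integrable (M := U)) => // x Dx; apply: le_trans (uU x Dx) _.
  by rewrite ler_piMr //; have := rn1 n x Dx; exact/le_trans/ler_norm.
have DE : D = D' `|` [set z] by rewrite setUC setDUK // => x ->.
have iuD' : m.-integrable D' (EFin \o u) by apply: integrableS iu.
rewrite [in Rintegral m D u]DE Rintegral_setU //; last 2 first.
- by rewrite -DE.
- by apply/disj_setPS => x [[_]].
have -> : Rintegral m [set z] u = u z * fine (m [set z]).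
  by rewrite -Rintegral_cst //; apply: eq_Rintegral => x; rewrite inE => ->.
rewrite addrK; apply: le_trans (le_normr_Rintegral _ iuD') _ => //.
apply: (@le_trans _ _ (Rintegral m D' (fun x => U * rho x ^+ n))).
  apply: le_Rintegral => //.
  - apply: (bounded_integrable (M := U)) => //.
    + by apply: measurableT_comp => //; exact: measurable_funS mu.
    + move=> x /D'D Dx; rewrite normr_id; apply: le_trans (uU x Dx) _.
      by rewrite ler_piMr //; have := rn1 n x Dx; exact/le_trans/ler_norm.
  - apply: (bounded_integrable (M := U)) => //.
    + exact: measurable_funM.
    + move=> x /D'D Dx; rewrite normrM ger0_norm // ler_piMr //; exact: rn1.
  - by move=> x /D'D; exact: uU.
rewrite RintegralZl // ler_wpM2l //.
by move: In; rewrite sub0r normrN => /ltW; exact/le_trans/ler_norm.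
Qed.
End PeakIntegral.

(** * Complex measures on the sphere *)

Section BorelSphere.
Variables (R : realType) (d : nat).
Local Notation C := R[i].

Lemma open_borel (U : set 'rV[C]_d) : open U -> measurable (U : set (borel R d)).
Proof. by move=> oU; apply: sub_sigma_algebra. Qed.

Lemma continuous_borel (f : 'rV[C]_d -> R) :
  continuous f -> measurable_fun [set: borel R d] (f : borel R d -> R).
Proof.
move=> /continuousP fc; apply: (measurability _ (RGenOInfty.measurableE R)) => //.
move=> _ [_ [a ->] <-]; rewrite setTI; apply: open_borel.
by rewrite preimage_itvoy; apply: (fc [set t | a < t]); exact: open_gt.
Qed.

Lemma esq_continuous (z : 'rV[C]_d) : continuous (fun x : 'rV[C]_d => esq (x - z)).
Proof.
move=> x; rewrite /continuous_at /esq.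
apply: (@cvg_seq_sum _ _ (nbhs x)) => i.
apply: (@cvg_pow _ _ (nbhs x)); apply: (@cvg_rnorm _ _ _ (nbhs x)).
have h : (fun y : 'rV[C]_d => y 0 i) @ x --> x 0 i by exact: coord_continuous.
rewrite !mxE (_ : (fun y : 'rV[C]_d => _) = (fun y => y 0 i - z 0 i)).
  exact: (@cvgB _ _ _ (nbhs x) _ _ _ _ _ h (cvg_cst _)).
by apply/funext => y; rewrite !mxE.
Qed.

Lemma measurable_esq_eq (z : 'rV[C]_d) (r : R) :
  measurable ([set x : 'rV[C]_d | esq (x - z) = r] : set (borel R d)).
Proof.
have := continuous_borel (@esq_continuous z).
by move=> /(_ measurableT [set r] (measurable_set1 r)); rewrite setTI.
Qed.

Lemma measurable_point (z : 'rV[C]_d) : measurable ([set z] : set (borel R d)).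
Proof.
rewrite (_ : [set z] = [set x : 'rV[C]_d | esq (x - z) = 0]); first exact: measurable_esq_eq.
apply/seteqP; split=> x /= => [->|/esq_eq0/subr0_eq//].
by rewrite subrr /esq big1 // => i _; rewrite mxE rnorm0 expr0n.
Qed.

Lemma measurable_sphere : measurable (@unit_sphere R d : set (borel R d)).
Proof.
rewrite (_ : @unit_sphere R d = [set x : 'rV[C]_d | esq (x - 0) = 1]).
  exact: measurable_esq_eq.
by apply/seteqP; split=> x /=; rewrite subr0 => /unit_sphereE.
Qed.

Lemma charge_peak (nu : {charge set (borel R d) -> \bar R}) (D : set (borel R d))
    (z : borel R d) (rho : borel R d -> R) (e : R) :
  measurable D -> measurable [set z] -> D z -> measurable_fun D rho ->
  (forall x, D x -> 0 <= rho x <= 1) -> (forall x, D x -> x <> z -> rho x < 1) -> 0 < e ->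
  \forall n \near \oo, forall (U : R) (u : borel R d -> R), 0 <= U -> measurable_fun D u ->
    (forall x, D x -> `|u x| <= U * rho x ^+ n) ->
    `|charge_integral nu D u - u z * fine (nu [set z])| <= U * e.
Proof.
move=> mD mz Dz mrho rho01 rho1 e0; rewrite /charge_integral.
move: (projT2 _) => nuPN.
have e20 : 0 < e / 2 by rewrite divr_gt0.
apply: filterS2 (peak_integral (jordan_pos nuPN) mD mz Dz mrho rho01 rho1 e20)
  (peak_integral (jordan_neg nuPN) mD mz Dz mrho rho01 rho1 e20) => n.
move=> hp hn U u U0 mu uU.
have {}hp := hp U u U0 mu uU; have {}hn := hn U u U0 mu uU.
have -> : fine (nu [set z]) = fine (jordan_pos nuPN [set z]) - fine (jordan_neg nuPN [set z]).
  rewrite (jordan_decomp nuPN mz) /cadd /= cscaleN1 fineB //; exact: fin_num_measure.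
move: hp hn; set a := Rintegral _ _ _; set b := Rintegral _ _ _.
set p := fine _; set q := fine _ => hp hn.
rewrite (_ : a - b - u z * (p - q) = (a - u z * p) - (b - u z * q)); last by ring.
apply: le_trans (ler_normB _ _) _; lra.
Qed.

Lemma cintegral_peak (mu : complex_measure R d) (D : set (borel R d))
    (z : borel R d) (rho : borel R d -> R) (e : R) :
  measurable D -> measurable [set z] -> D z -> measurable_fun D rho ->
  (forall x, D x -> 0 <= rho x <= 1) -> (forall x, D x -> x <> z -> rho x < 1) -> 0 < e ->
  exists n, forall (U : R) (F : borel R d -> C), 0 <= U ->
    measurable_fun D (fun x => complex.Re (F x)) ->
    measurable_fun D (fun x => complex.Im (F x)) ->
    (forall x, D x -> rnorm (F x) <= U * rho x ^+ n) ->
    rnorm (cintegral mu D F - F z * cmeas mu [set z]) <= U * e.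
Proof.
move=> mD mz Dz mrho rho01 rho1 e0.
have e40 : 0 < e / 4 by rewrite divr_gt0.
have [N _ NP] := filterI (charge_peak (re_part mu) mD mz Dz mrho rho01 rho1 e40)
  (charge_peak (im_part mu) mD mz Dz mrho rho01 rho1 e40).
have [hr hi] := NP N (leqnn N).
exists N => U F U0 mRe mIm FU.
have bR x : D x -> `|complex.Re (F x)| <= U * rho x ^+ N.
  by move=> /FU; apply: le_trans; exact: ler_Re_rnorm.
have bI x : D x -> `|complex.Im (F x)| <= U * rho x ^+ N.
  by move=> /FU; apply: le_trans; exact: ler_Im_rnorm.
have h1 := hr U _ U0 mRe bR; have h2 := hr U _ U0 mIm bI.
have h3 := hi U _ U0 mRe bR; have h4 := hi U _ U0 mIm bI.
apply: le_trans (ler_rnorm_ReIm _) _.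
rewrite /cintegral /cmeas; move: h1 h2 h3 h4; case: (F z) => x y /=.
set a := fine _; set b := fine _; set A := charge_integral _ _ _; set A' := charge_integral _ _ _.
set B := charge_integral _ _ _; set B' := charge_integral _ _ _ => h1 h2 h3 h4.
rewrite (_ : A - B' - _ = (A - x * a) - (B' - y * b)); last by ring.
rewrite (_ : A' + B - _ = (A' - y * a) + (B - x * b)); last by ring.
have := ler_normB (A - x * a) (B' - y * b); have := ler_normD (A' - y * a) (B - x * b); lra.
Qed.

(** A countable partition of a point has one nonempty piece. *)
Lemma cmeas_point_neq0 (mu : complex_measure R d) (z : borel R d) :
  measurable [set z] -> Defs.total_variation mu [set z] <> 0%E -> cmeas mu [set z] <> 0.
Proof.
move=> mz tv0 cz; apply: tv0; rewrite /Defs.total_variation.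
have c0 : cmeas mu set0 = 0 by rewrite /cmeas !charge0.
rewrite (_ : [set _ | F in _] = [set 0%E]); first by rewrite ereal_sup1.
apply/seteqP; split=> [_ [F [mF tF UF] <-]|_ ->] /=.
  rewrite eseries0 // => k _ _; suff -> : cmeas mu (F k) = 0 by rewrite rnorm0.
  have Fz : F k `<=` [set z] by rewrite -UF; exact: bigcup_sup.
  by have [->|->] := subset_set1 Fz.
exists (fun k => if k == 0%N then [set z] else set0); last first.
  by rewrite eseries0 // => k _ _; case: eqP => _; rewrite ?cz ?c0 rnorm0.
split=> [k||].
- by case: eqP.
- by move=> i j _ _; case: eqP => [->|_]; case: eqP => [->|_] //= -[x []].
- by apply/seteqP; split=> [x [k _]|x xz]; [case: eqP|exists 0%N].
Qed.

End BorelSphere.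

(** * Norm continuity of evaluations on the sphere *)

Section Peak.
Variables (R : realType) (d : nat).
Local Notation C := R[i].
Implicit Types (x z : 'rV[C]_d).

(** On the sphere, a polynomial that equals [1] at [z] and is smaller than [1] in
    modulus elsewhere. *)
Definition peak z x : C := (1 + cdot x z) / 2%:R.

Lemma polynomial_fun_peak z : polynomial_fun (peak z).
Proof.
apply: polynomial_funM; last exact: polynomial_fun_cst.
by apply: polynomial_funD; [exact: polynomial_fun_cst|exact: polynomial_fun_cdot].
Qed.

Lemma peak_point z : esq z = 1 -> peak z z = 1.
Proof.
by move=> z1; rewrite /peak cdotzz z1 (rmorph1 (real_complex R)) -(natrD _ 1 1) divff ?pnatr_eq0.
Qed.

Lemma rnorm_peak z x : esq z = 1 -> esq x = 1 -> rnorm (peak z x) ^+ 2 <= 1 - esq (x - z) / 4.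
Proof.
move=> z1 x1; rewrite esqB x1 z1.
have : rnorm (cdot x z) ^+ 2 <= 1 by rewrite (le_trans (rnorm_cdot _ _)) // x1 z1 mulr1.
have sq (c : C) : rnorm c ^+ 2 = complex.Re c ^+ 2 + complex.Im c ^+ 2.
  by rewrite /rnorm normc_def /= sqr_sqrtr // addr_ge0 ?sqr_ge0.
rewrite /peak (_ : 2%:R^-1 = (2^-1)%:C :> C); last by rewrite fmorphV rmorph_nat.
rewrite rnormM rnormr ger0_norm // exprMn !sq; case: (cdot x z) => a b /= h.
nra.
Qed.

Lemma rnorm_peak_le1 z x : esq z = 1 -> esq x = 1 -> rnorm (peak z x) <= 1.
Proof.
move=> z1 x1; have := rnorm_peak z1 x1; have := esq_ge0 (x - z) => h1 h2.
rewrite -(@expr_le1 _ 2) ?rnorm_ge0 //; lra.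
Qed.

Lemma rnorm_peak_lt1 z x : esq z = 1 -> esq x = 1 -> x <> z -> rnorm (peak z x) < 1.
Proof.
move=> z1 x1 xz; have := rnorm_peak z1 x1.
have h1 : 0 < esq (x - z).
  rewrite lt_neqAle esq_ge0 andbT eq_sym; apply/eqP => /esq_eq0/subr0_eq; exact: xz.
by move=> h2; rewrite -(@expr_lt1 _ 2) ?rnorm_ge0 //; lra.
Qed.
End Peak.

Section Modulus.
Variables (R : realType) (d : nat) (H : rkhs R (@unit_ball R d)).
Hypothesis hH : regular_unitarily_invariant H.
Local Notation C := R[i].
Implicit Types (z w : 'rV[C]_d) (f g q k : multiplier H).

(** [rnorm_multiplier] in the open ball, and its density in the closed one. *)
Lemma rnorm_peval f p w : is_polynomial f p -> esq w <= 1 -> rnorm (peval p w) <= mnorm f.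
Proof.
move=> fp; apply: closed_ball_bound.
  by apply: continuous_subspaceT; apply: polynomial_fun_continuous; exists p.
move=> x x1; have [y yx] := ball_point x1.
by rewrite -yx -fp; exact: (rnorm_mult hH).
Qed.

(** The continuity of [inner_mulop_moves] passes to the functionals
    [f |-> tr (M_f M_q A)], by [trace_mulop_le]. *)
Lemma trace_moves_near z q (s : seq (@trace_class R _ H)) (e : R) : esq z = 1 -> 0 < e ->
  \forall w \near z, esq w = 1 -> forall T f g k, moves_ball z w T ->
    (forall x, g x = f (T x)) -> Defs.mfun k = Defs.mfun (g - f) * Defs.mfun q ->
    \sum_(j <- s) rnorm (trace_pairing k j) <= e * mnorm f.
Proof.
move=> z1; elim: s e => [|j s IH] e e0.
  apply: (@filterE _ (nbhs z)) => w _ T f g k _ _ _.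
  by rewrite big_nil mulr_ge0 ?mnorm_ge0 // ltW.
have e20 : 0 < e / 2 by rewrite divr_gt0.
have e80 : 0 < e / 8 by rewrite divr_gt0.
have [x [y jxy]] := set_valP j.
have [N NP] := trace_mulop_le q jxy e80.
have near_sum : \forall w \near z, esq w = 1 -> forall T f g, moves_ball z w T ->
    (forall x, g x = f (T x)) ->
    \sum_(0 <= i < N) rnorm (inner H (mulop (g - f) (mulop q (x i))) (y i)) <= e / 4 * mnorm f.
  have d0 : 0 < e / 4 / (N%:R + 1) by rewrite !divr_gt0 // ltr_wpDl.
  have : forall n : nat, \forall w \near z, esq w = 1 -> forall T f g, moves_ball z w T ->
    (forall x, g x = f (T x)) ->
    \sum_(0 <= i < n) rnorm (inner H (mulop (g - f) (mulop q (x i))) (y i)) <=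
      n%:R * (e / 4 / (N%:R + 1)) * mnorm f.
    elim=> [|n IHn].
      by apply: (@filterE _ (nbhs z)) => w _ T f g _ _; rewrite big_geq // !mul0r.
    apply: (@filterS2 _ (nbhs z) _ _ _ _ _ IHn
      (inner_mulop_moves hH (mulop q (x n)) (y n) z1 d0)) => w h1 h2 w1 T f g Tzw gf.
    by rewrite big_nat_recr //= -natr1 2!mulrDl mul1r lerD ?(h1 w1 T) ?(h2 w1 T).
  move=> /(_ N); apply: (@filterS _ (nbhs z)) => w h w1 T f g Tzw gf.
  apply: le_trans (h w1 T f g Tzw gf) _; rewrite ler_wpM2r ?mnorm_ge0 //.
  rewrite mulrA ler_pdivrMr ?ltr_wpDl // mulrC ler_wpM2l ?lerDl //; lra.
apply: (@filterS2 _ (nbhs z) _ _ _ _ _ (IH _ e20) near_sum) => w h1 h2 w1 T f g k Tzw gf kE.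
rewrite big_cons [e]splitr mulrDl lerD //; last exact: (h1 w1 T f g).
apply: le_trans (NP k (g - f) kE) _.
have gf1 : mnorm g <= mnorm f by exact: (mnorm_moves hH z1 w1 Tzw gf).
have gf2 : mnorm (g - f) <= 2 * mnorm f by have := mnormB g f; lra.
have := h2 w1 T f g Tzw gf; have : e / 8 * mnorm (g - f) <= e / 8 * (2 * mnorm f).
  by rewrite ler_pM2l.
lra.
Qed.

(** The evaluations at points of the sphere are norm continuous at a point [z]
    charged by a Henkin measure [mu]. Integrating a polynomial against
    [peak z ^+ n * mu] approximates its value at [z], times the mass of [z], with
    an error that is small compared to the supremum norm, hence to the
    multiplier norm. These integrals are weak-star continuous functionals, so
    they vary little when the polynomial is composed with the unitary map
    [move_point z w]; and this composition turns the value at [z] into the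
    value at [w]. *)
Lemma henkin_point_modulus mu z (e : R) : henkin H mu -> esq z = 1 ->
  cmeas mu [set z] <> 0 -> 0 < e ->
  \forall w \near z, esq w = 1 -> forall p f, is_polynomial f p ->
    rnorm (peval p w - peval p z) <= e * mnorm f.
Proof.
move=> [_ [phi [phiC phiP]]] z1 /eqP c0 e0.
set c := cmeas mu [set z] in c0.
have cp : 0 < rnorm c.
  by rewrite lt_neqAle eq_sym rnorm_ge0 andbT; apply: contra_neq c0 => /rnorm_eq0.
have polycont (u : 'rV[C]_d -> C) : polynomial_fun u -> continuous u.
  exact: polynomial_fun_continuous.
have mcont (f : 'rV[C]_d -> C) (g : C -> R) : continuous f ->
    (forall x y, `|g x - g y| <= rnorm (x - y)) ->
    measurable_fun (@unit_sphere R d : set (borel R d)) (fun x : borel R d => g (f x)).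
  move=> fc gl; apply: measurable_funTS; apply: continuous_borel => x.
  apply/(@cvgrPdist_lt _ _ _ (nbhs x)) => t t0.
  have /(@cvg_rnormP _ _ _ (nbhs x))/(_ _ t0) := fc x.
  by apply: (@filterS _ (nbhs x)) => y; rewrite rdistC; apply: le_lt_trans; exact: gl.
have gRe x y : `|complex.Re x - complex.Re y| <= rnorm (x - y : C).
  by have := ler_Re_rnorm (x - y); case: x y => a b [a' b'].
have gIm x y : `|complex.Im x - complex.Im y| <= rnorm (x - y : C).
  by have := ler_Im_rnorm (x - y); case: x y => a b [a' b'].
have gN (x y : C) : `|rnorm x - rnorm y| <= rnorm (x - y).
  have := ler_rnormD (x - y) y; have := ler_rnormD (y - x) x.
  by rewrite !subrK (rdistC y) ler_norml; lra.
have [n nP] : exists n, forall (U : R) (F : borel R d -> C), 0 <= U ->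
    measurable_fun (@unit_sphere R d : set (borel R d)) (fun x => complex.Re (F x)) ->
    measurable_fun (@unit_sphere R d : set (borel R d)) (fun x => complex.Im (F x)) ->
    (forall x, (@unit_sphere R d) x -> rnorm (F x) <= U * rnorm (peak z x) ^+ n) ->
    rnorm (cintegral mu (@unit_sphere R d) F - F z * cmeas mu [set z]) <= U * (rnorm c * e / 4).
  apply: cintegral_peak.
  - exact: measurable_sphere.
  - exact: measurable_point.
  - exact/unit_sphereE.
  - by apply: (mcont (peak z) (@rnorm R C)) => //; apply: polycont; exact: polynomial_fun_peak.
  - by move=> x /unit_sphereE x1; rewrite rnorm_ge0 rnorm_peak_le1.
  - by move=> x /unit_sphereE x1; exact: rnorm_peak_lt1.
  - by rewrite !divr_gt0 // mulr_gt0.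
have [s [M [M0 phiM]]] := weak_star_bound phiC.
have [qp qpE] := polynomial_funX n (polynomial_fun_peak z).
have [q qE _] := phiP qp.
have d0 : 0 < rnorm c * e / 2 / (M + 1) by rewrite !divr_gt0 ?mulr_gt0 // ltr_wpDl.
apply: (@filterS2 _ (nbhs z) _ _ _ _ _ (trace_moves_near q s z1 d0) (move_point_defined z1)).
move=> w tw zw w1 p f fp.
have [T Tzw] := moves_ball_ex z1 w1.
have [p' p'E] : polynomial_fun (peval p \o move_point z w).
  by apply: polynomial_fun_comp; [exists p|exact: polynomial_fun_move_point].
have [g gp _] := phiP p'.
have gf x : g x = f (T x) by rewrite gp fp Tzw -p'E.
(* pk = (p' - p) * peak ^+ n takes the value p(w) - p(z) at z. *)
have [pk pkE] : polynomial_fun (fun x => (peval p' x - peval p x) * peak z x ^+ n).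
  apply: polynomial_funM; last exact: (polynomial_funX n (polynomial_fun_peak z)).
  apply: polynomial_funD; first by exists p'.
  under eq_fun do rewrite -mulN1r.
  by apply: polynomial_funM; [exact: polynomial_fun_cst|exists p].
have [k kp kphi] := phiP pk.
have kE : Defs.mfun k = Defs.mfun (g - f) * Defs.mfun q.
  apply/funext => x; rewrite kp -pkE.
  have -> : (Defs.mfun (g - f) * Defs.mfun q) x = (g x - f x) * q x by [].
  by rewrite gp fp qE -qpE.
have nf := mnorm_ge0 f.
have gf1 : mnorm g <= mnorm f by exact: (mnorm_moves hH z1 w1 Tzw gf).
have b1 : rnorm (phi k) <= rnorm c * e / 2 * mnorm f.
  apply: le_trans (phiM k) _.
  apply: (@le_trans _ _ (M * (rnorm c * e / 2 / (M + 1) * mnorm f))).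
    by rewrite ler_wpM2l // (tw w1 T f g).
  rewrite mulrA ler_wpM2r // mulrA ler_pdivrMr ?ltr_wpDl // mulrC.
  by rewrite ler_wpM2l ?lerDl // ltW // divr_gt0 // mulr_gt0.
have Fz : peval pk z = peval p w - peval p z.
  by rewrite -pkE peak_point // expr1n mulr1 -p'E /= move_pointE.
have b2 : rnorm (cintegral mu (@unit_sphere R d) (peval pk) - peval pk z * c) <=
    2 * mnorm f * (rnorm c * e / 4).
  apply: nP; first by rewrite mulr_ge0.
  - by apply: (mcont _ (@complex.Re R)) => //; apply: polycont; exists pk.
  - by apply: (mcont _ (@complex.Im R)) => //; apply: polycont; exists pk.
  - move=> x /unit_sphereE x1; rewrite -pkE rnormM rnormX ler_wpM2r ?exprn_ge0 ?rnorm_ge0 //.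
    apply: le_trans (ler_rnormB _ _) _.
    have := rnorm_peval (w := x) gp; have := rnorm_peval (w := x) fp.
    by rewrite x1 lexx => /(_ isT) h1 /(_ isT) h2; lra.
rewrite -(ler_pM2r cp) -rnormM -Fz.
have := ler_rdistD (phi k) (peval pk z * c) 0; rewrite !subr0 kphi (rdistC (peval pk z * c)).
rewrite kphi in b1; lra.
Qed.
End Modulus.

(** * Interpolation sets *)

Section PointDistance.
Variables (R : realType) (d : nat) (H : rkhs R (@unit_ball R d)).
Hypothesis hH : regular_unitarily_invariant H.
Local Notation C := R[i].
Implicit Types (z w : 'rV[C]_d) (f g q k : multiplier H).

(** As [t / 0 = 0], a multiplier of norm [0] contributes the harmless value [0]. *)
Definition dist_set z w : set R :=
  [set t | exists p f, is_polynomial f p /\ t = rnorm (peval p w - peval p z) / mnorm f].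
(** The distance of the evaluation functionals at [z] and [w], in the dual of the
    polynomials with the multiplier norm. *)
Definition eval_dist z w : R := sup (dist_set z w).

Lemma dist_set_le z w (e : R) : 0 <= e ->
  (forall p f, is_polynomial f p -> rnorm (peval p w - peval p z) <= e * mnorm f) ->
  ubound (dist_set z w) e.
Proof.
move=> e0 h _ [p [f [fp ->]]]; have [f0|f0] := eqVneq (mnorm f) 0.
  by rewrite f0 invr0 mulr0.
by rewrite ler_pdivrMr ?h // lt_neqAle eq_sym f0 mnorm_ge0.
Qed.

Lemma rnorm_pevalB f p z w : is_polynomial f p -> esq z <= 1 -> esq w <= 1 ->
  rnorm (peval p w - peval p z) <= 2 * mnorm f.
Proof.
move=> fp z1 w1; apply: le_trans (ler_rnormB _ _) _.
by have := rnorm_peval hH fp z1; have := rnorm_peval hH fp w1; lra.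
Qed.

Lemma zero_polynomial : is_polynomial (0 : multiplier H) (mpoly.mpolyC d 0).
Proof. by move=> x; rewrite /peval mpoly.mevalC. Qed.

Lemma dist_set_has_sup z w : esq z <= 1 -> esq w <= 1 -> has_sup (dist_set z w).
Proof.
move=> z1 w1; split; last first.
  by exists 2; apply: dist_set_le => // p f fp; exact: rnorm_pevalB.
by eexists; exists (mpoly.mpolyC d 0), 0; split; [exact: zero_polynomial|].
Qed.

Lemma eval_dist_le z w (e : R) : esq z <= 1 -> esq w <= 1 -> 0 <= e ->
  (forall p f, is_polynomial f p -> rnorm (peval p w - peval p z) <= e * mnorm f) ->
  eval_dist z w <= e.
Proof.
move=> z1 w1 e0 h; apply: ge_sup; first by case: (dist_set_has_sup z1 w1).
exact: dist_set_le.
Qed.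

Lemma eval_dist_ge0 z w : esq z <= 1 -> esq w <= 1 -> 0 <= eval_dist z w.
Proof.
move=> z1 w1; apply: sup_upper_bound; first exact: dist_set_has_sup.
exists (mpoly.mpolyC d 0), 0; split; first exact: zero_polynomial.
by rewrite /peval !mpoly.mevalC subrr rnorm0 mul0r.
Qed.

Lemma rnorm_pevalB_dist f p z w : is_polynomial f p -> esq z <= 1 -> esq w <= 1 ->
  rnorm (peval p w - peval p z) <= eval_dist z w * mnorm f.
Proof.
move=> fp z1 w1; have [f0|f0] := eqVneq (mnorm f) 0.
  by have := rnorm_pevalB fp z1 w1; rewrite f0 !mulr0.
rewrite -ler_pdivrMr; last by rewrite lt_neqAle eq_sym f0 mnorm_ge0.
by apply: sup_upper_bound; [exact: dist_set_has_sup|exists p, f].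
Qed.

Lemma eval_dist_trans z w v (e : R) : esq z <= 1 -> esq w <= 1 -> esq v <= 1 -> 0 <= e ->
  (forall p f, is_polynomial f p -> rnorm (peval p v - peval p w) <= e * mnorm f) ->
  `|eval_dist z v - eval_dist z w| <= e.
Proof.
move=> z1 w1 v1 e0 h.
have h1 : eval_dist z v <= eval_dist z w + e.
  apply: (eval_dist_le z1 v1) => [|p f fp]; first by rewrite addr_ge0 ?eval_dist_ge0.
  apply: le_trans (ler_rdistD (peval p w) _ _) _.
  by rewrite mulrDl addrC lerD ?rnorm_pevalB_dist ?h.
have h2 : eval_dist z w <= eval_dist z v + e.
  apply: (eval_dist_le z1 w1) => [|p f fp]; first by rewrite addr_ge0 ?eval_dist_ge0.
  apply: le_trans (ler_rdistD (peval p v) _ _) _; rewrite (rdistC (peval p w)).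
  by rewrite mulrDl addrC lerD ?rnorm_pevalB_dist ?h.
by rewrite ler_norml; lra.
Qed.

Lemma eval_dist_xx z : esq z <= 1 -> eval_dist z z = 0.
Proof.
move=> z1; apply/eqP; rewrite eq_le eval_dist_ge0 // andbT.
by apply: eval_dist_le => // p f _; rewrite subrr rnorm0 mul0r.
Qed.

(** The estimate holds for polynomials by the definition of [eval_dist], and passes
    to their limits in the multiplier norm, which dominates the supremum norm
    on the closed ball. *)
Lemma ball_algebra_modulus f F z w : ball_algebra f -> continuous_extension f F ->
  esq z <= 1 -> esq w <= 1 -> rnorm (F w - F z) <= eval_dist z w * mnorm f.
Proof.
move=> fA [Fc Ff] z1 w1; apply/ler_addgt0Pl => e e0.
have d0 := eval_dist_ge0 z1 w1.
(* Two errors t at z and w, and t * eval_dist z w from replacing f by q. *)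
pose t := e / (2 + eval_dist z w).
have t0 : 0 < t by rewrite divr_gt0 // ltr_pwDl.
have [p [q qp]] := fA t t0; rewrite mnormE lte_fin => fq.
have Fp v : esq v <= 1 -> rnorm (F v - peval p v) <= t.
  apply: (closed_ball_bound (G := fun v => F v - peval p v)).
    have pc : {within @closed_unit_ball R d, continuous (peval p : 'rV[C]_d -> C)}.
      by apply: continuous_subspaceT; apply: polynomial_fun_continuous; exists p.
    move=> x; exact: (@cvgB _ _ _ (nbhs x) _ _ _ _ _ (Fc x) (pc x)).
  move=> x x1; have [y yx] := ball_point x1.
  rewrite -yx Ff -qp; apply: le_trans (ltW fq).
  exact: (rnorm_mult hH (f - q) y).
have qn : mnorm q <= mnorm f + t.
  have -> : q = f - (f - q) by rewrite opprB addrC subrK.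
  by apply: le_trans (mnormB _ _) _; lra.
have h1 := Fp w w1; have h2 := Fp z z1.
have h3 := rnorm_pevalB_dist qp z1 w1.
have h4 : eval_dist z w * mnorm q <= eval_dist z w * (mnorm f + t) by rewrite ler_wpM2l.
have := ler_rdistD (peval p w) (F w) (F z); have := ler_rdistD (peval p z) (peval p w) (F z).
rewrite (rdistC (peval p z)).
have -> : e = t * 2 + eval_dist z w * t by rewrite /t; field; rewrite gt_eqF // ltr_pwDl.
rewrite mulrDr in h4; lra.
Qed.

End PointDistance.

Section Interpolation.
Variables (R : realType) (d : nat) (H : rkhs R (@unit_ball R d)).
Local Notation C := R[i].
Implicit Types (z w : 'rV[C]_d) (f g q k : multiplier H).

(** Newton's scheme: the correction [l] vanishes at the previous points and equals
    [1] at the new one. *)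
Lemma polynomial_interpolation (s : seq 'rV[C]_d) (g : 'rV[C]_d -> C) :
  exists2 p, polynomial_fun p & forall z, z \in s -> p z = g z.
Proof.
elim: s => [|z s [p pP pg]]; first by exists (fun=> 0) => //; exact: polynomial_fun_cst.
have [zs|zs] := boolP (z \in s).
  by exists p => // w; rewrite inE => /predU1P[->|]; exact: pg.
have [l lP [lz ls]] : exists2 l, polynomial_fun l & l z = 1 /\ forall w, w \in s -> l w = 0.
  elim: s zs {pg} => [_|w s IH]; first by exists (fun=> 1); [exact: polynomial_fun_cst|].
  rewrite inE negb_or => /andP[zw /IH[l lP [lz ls]]].
  have [i zwi] : exists i, z 0 i != w 0 i.
    apply/existsP; apply: contraNT zw => /existsPn h; apply/eqP/rowP => i.
    by apply/eqP; have := h i; rewrite negbK.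
  exists (fun x => l x * ((x 0 i + - w 0 i) * (z 0 i - w 0 i)^-1)).
    apply: polynomial_funM => //; apply: polynomial_funM; last exact: polynomial_fun_cst.
    by apply: polynomial_funD; [exact: polynomial_fun_coord|exact: polynomial_fun_cst].
  split; first by rewrite lz mul1r divff // subr_eq0.
  move=> x; rewrite inE => /predU1P[->|/ls ->]; last by rewrite mul0r.
  by rewrite subrr mul0r mulr0.
exists (fun x => p x + (g z - p z) * l x).
  apply: polynomial_funD => //; apply: polynomial_funM => //; exact: polynomial_fun_cst.
move=> w; rewrite inE => /predU1P[->|ws]; first by rewrite lz mulr1 addrC subrK.
by rewrite ls // mulr0 addr0 pg.
Qed.

Lemma finite_interpolation_set (E : set 'rV[C]_d) :
  (forall p, exists f : multiplier H, is_polynomial f p) -> finite_set E ->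
  interpolation_set H E.
Proof.
move=> polyM /finite_seqP[s ->] g _.
have [_ [p ->] pg] := polynomial_interpolation s g.
have [f fp] := polyM p; exists f.
  move=> e e0; exists p, f => //; rewrite mnormE lte_fin subrr; apply: le_lt_trans e0.
  apply: mnorm_le => // h; rewrite (_ : mulop 0 h = 0) ?rnorm0 ?mul0r //.
  by apply: mulopP; rewrite raddf0 mul0r.
exists (peval p) => //; split; last by move=> x; rewrite fp.
by apply: continuous_subspaceT; apply: polynomial_fun_continuous; exists p.
Qed.

Lemma compact_isolated_finite (E : set 'rV[C]_d) : compact E ->
  (forall z, E z -> \forall w \near z, E w -> w = z) -> finite_set E.
Proof.
rewrite compact_cover => cE iso.
have [] := cE 'rV[C]_d E (fun z => interior [set w | E w -> w = z]).
- by move=> z _; exact: open_interior.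
- by move=> z Ez; exists z => //; exact: iso.
move=> D DE ED; apply: (sub_finite_set _ (finite_fset D)) => z Ez.
by have [w wD /interior_subset/(_ Ez) ->] := ED z Ez.
Qed.

Hypothesis hH : regular_unitarily_invariant H.
Hypothesis polyM : forall p, exists f : multiplier H, is_polynomial f p.
Hypothesis modulus : forall z (e : R), esq z = 1 -> 0 < e ->
  \forall w \near z, esq w = 1 -> forall p f, is_polynomial f p ->
    rnorm (peval p w - peval p z) <= e * mnorm f.

Lemma eval_dist_eq0 z w : esq z <= 1 -> esq w <= 1 -> eval_dist H z w = 0 -> w = z.
Proof.
move=> z1 w1 d0; apply/rowP => i; apply/subr0_eq/rnorm_eq0/eqP.
rewrite eq_le rnorm_ge0 andbT.
have [p pE] := @polynomial_fun_coord R d i; have [f fp] := polyM p.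
by have := rnorm_pevalB_dist hH fp z1 w1; rewrite d0 mul0r -pE.
Qed.

Lemma eval_dist_near z w (e : R) : esq z = 1 -> esq w = 1 -> 0 < e ->
  \forall v \near w, esq v = 1 -> `|eval_dist H z v - eval_dist H z w| <= e.
Proof.
move=> z1 w1 e0; apply: (@filterS _ (nbhs w) _ _ _ _ (modulus w1 e0)) => v h v1.
by apply: (eval_dist_trans hH); rewrite ?z1 ?w1 ?v1 ?(ltW e0) //; exact: (h v1).
Qed.

(** An extension of the square root of [eval_dist z] to an element of the ball
    algebra would satisfy [sqrt t <= A * t] for [t = eval_dist z w], which
    excludes small positive values of [t]. As [eval_dist z] is continuous and
    vanishes at [z] only, points of the set near [z] are equal to [z]. *)
Lemma interpolation_isolated (E : set 'rV[C]_d) z : E `<=` @unit_sphere R d ->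
  interpolation_set H E -> E z -> \forall w \near z, E w -> w = z.
Proof.
move=> ES EI Ez; have z1 : esq z = 1 by apply/unit_sphereE; exact: ES.
have [f fA [F fF FE]] : exists2 f : multiplier H, ball_algebra f &
    exists2 F, continuous_extension f F &
      forall w, E w -> F w = (Num.sqrt (eval_dist H z w))%:C.
  apply: EI; apply/subspace_continuousP => w Ew.
  have w1 : esq w = 1 by apply/unit_sphereE; exact: ES.
  have h : eval_dist H z v @[v --> within E (nbhs w)] --> eval_dist H z w.
    apply/cvgrPdist_le => e e0; rewrite near_withinE.
    apply: (@filterS _ (nbhs w) _ _ _ _ (eval_dist_near z1 w1 e0)) => v hv Ev.
    by rewrite distrC; apply: hv; apply/unit_sphereE; exact: ES.
  have {}h := cvg_comp _ _ h (@sqrt_continuous R (eval_dist H z w)).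
  apply/cvg_rnormP => e e0; move/cvgrPdist_lt : h => /(_ _ e0); apply: filterS => v hv.
  have := rdistr (Num.sqrt (eval_dist H z v)) (Num.sqrt (eval_dist H z w)).
  rewrite distrC => ->.
  exact: hv.
have nf := mnorm_ge0 f; pose A := mnorm f + 1.
have A0 : 0 < A by rewrite ltr_wpDl.
(* Below A ^- 2, a positive t does not satisfy sqrt t <= A * t. *)
have e0 : 0 < A ^- 2 / 2 by rewrite divr_gt0 // invr_gt0 exprn_gt0.
apply: (@filterS _ (nbhs z) _ _ _ _ (eval_dist_near z1 z1 e0)) => w hw Ew.
have w1 : esq w = 1 by apply/unit_sphereE; exact: ES.
have := hw w1; rewrite eval_dist_xx ?z1 // subr0.
have d0 : 0 <= eval_dist H z w by rewrite eval_dist_ge0 ?z1 ?w1.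
rewrite ger0_norm // => dw.
have := ball_algebra_modulus hH fA fF (z := z) (w := w).
rewrite !FE // eval_dist_xx ?z1 ?w1 // sqrtr0 subr0 rnormr.
move=> /(_ (lexx _) (lexx _)); rewrite ger0_norm ?sqrtr_ge0 // => ds.
apply: eval_dist_eq0; rewrite ?z1 ?w1 //.
move: ds dw; rewrite -{2 3 4}(sqr_sqrtr d0); have := sqrtr_ge0 (eval_dist H z w).
set s := Num.sqrt _ => s0 ds dw.
have [s00|s00] := eqVneq s 0; first by rewrite s00 expr0n.
have sp : 0 < s by rewrite lt_neqAle eq_sym s00.
have sA : 1 <= s * A.
  rewrite -(ler_pM2l sp) mulr1 mulrA -expr2 (le_trans ds) // ler_wpM2l ?sqr_ge0 //.
  by rewrite lerDl.
have : s ^+ 2 * A ^+ 2 <= 1 / 2 by rewrite -ler_pdivlMr ?exprn_gt0 // div1r mulrC.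
have : 1 <= (s * A) ^+ 2 by rewrite exprn_ege1.
rewrite exprMn; lra.
Qed.
End Interpolation.

Theorem proposition10p4 (R : realType) (d : nat) (hd : (0 < d)%N)
    (H : rkhs R (@unit_ball R d)) (hH : regular_unitarily_invariant H)
    (hnull : ~ exists E : set (borel R d), E !=set0 /\ totally_null H E)
    (E : set 'rV[R[i]]_d) (hE : compact E) (hES : E `<=` @unit_sphere R d) :
  interpolation_set H E <-> finite_set E.
Proof.
have henkin_mass (z : borel R d) : esq z = 1 ->
    exists2 mu, henkin H mu & cmeas mu [set z] <> 0.
  move=> z1; apply: contrapT => noH; apply: hnull; exists [set z]; split; first by exists z.
  split; first exact: measurable_point; first by move=> _ ->; apply/unit_sphereE.
  move=> mu muH; apply: contrapT => tv; apply: noH; exists mu => //.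
  by apply: cmeas_point_neq0 => //; exact: measurable_point.
have polyM p : exists f : multiplier H, is_polynomial f p.
  have e1 : esq (delta_mx 0 (Ordinal hd) : 'rV[R[i]]_d) = 1.
    rewrite /esq (bigD1 (Ordinal hd)) //= mxE !eqxx rnorm1 expr1n big1 ?addr0 // => i ne.
    by rewrite mxE (negPf ne) andbF rnorm0 expr0n.
  have [mu [_ [phi [_ phiP]]] _] := henkin_mass _ e1.
  by have [f fp _] := phiP p; exists f.
split=> [EI|]; last exact: finite_interpolation_set.
apply: compact_isolated_finite => // z Ez.
apply: (interpolation_isolated hH polyM _ hES EI Ez) => w e w1 e0.
by have [mu muH mu0] := henkin_mass w w1; exact: (henkin_point_modulus hH muH w1 mu0 e0).
Qed.
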